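(* For all $p,q\in[1,\infty]$, the $(p,q)$-Gromov-Wasserstein distance $d_{\mathrm{GW}p,q}$ is a metric on the collection of isomorphism classes of $\mathcal{G}_w$. Furthermore, for all $p,p',q,q'\in[1,\infty]$ with $p\le p'$ and $q\le q'$, one has $d_{\mathrm{GW}p,q}\le d_{\mathrm{GW}p',q'}$, i.e. $d_{\mathrm{GW}p,q}(X,Y)\le d_{\mathrm{GW}p',q'}(X,Y)$ for all $X,Y\in\mathcal{G}_w$.
   Context: $\mathcal{G}_w$ is the collection of metric measure spaces: triples $(X,d_X,\mu_X)$ with $(X,d_X)$ a compact metric space and $\mu_X$ a Borel probability measure on $X$ with full support, $\mathrm{supp}[\mu_X]=X$. Two such spaces are isomorphic if there is a bijective isometry $X\to Y$ pushing $\mu_X$ forward to $\mu_Y$. $\mathcal{M}(\mu_X,\mu_Y)$ is the set of couplings, i.e. Borel probability measures on $X\times Y$ with marginals $\mu_X$ and $\mu_Y$. For $a,b\ge0$: $\Lambda_q(a,b):=|a^q-b^q|^{1/q}$ if $q<\infty$; $\Lambda_\infty(a,b):=\max\{a,b\}$ if $a\ne b$ and $\Lambda_\infty(a,a):=0$. For $\gamma\in\mathcal{M}(\mu_X,\mu_Y)$ the $(p,q)$-distortion is $$\mathrm{dis}_{p,q}(\gamma):=\left(\int_{X\times Y}\int_{X\times Y}\big(\Lambda_q(d_X(x,x'),d_Y(y,y'))\big)^p\,\gamma(dx\times dy)\,\gamma(dx'\times dy')\right)^{1/p}$$ for $1\le p<\infty$, and $\mathrm{dis}_{\infty,q}(\gamma):=\sup_{(x,y),(x',y')\in\mathrm{supp}[\gamma]}\Lambda_q(d_X(x,x'),d_Y(y,y'))$.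 The $(p,q)$-Gromov-Wasserstein distance is $d_{\mathrm{GW}p,q}(X,Y):=\frac12\inf_{\gamma\in\mathcal{M}(\mu_X,\mu_Y)}\mathrm{dis}_{p,q}(\gamma)$. *)

(* Defs.v *)
From HB Require Import structures.
From mathcomp Require Import all_boot all_order all_algebra.
From mathcomp Require Import all_classical all_reals all_analysis.
Import Order.TTheory GRing.Theory Num.Theory.
Import numFieldNormedType.Exports.

Set Implicit Arguments.
Unset Strict Implicit.
Unset Printing Implicit Defensive.

Local Open Scope classical_set_scope.
Local Open Scope ring_scope.

(* A measurableType has to be pointed. A space that carries a probability
   measure is nonempty, so requiring a base point excludes nothing; no notion
   below mentions it. *)
#[short(type="pmetricType")]
HB.structure Definition PointedMetric (R : numDomainType) :=
  {T of Pointed T & Metric R T}.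

Notation borel T := (g_sigma_algebraType (@open T)).

Definition supp (R : realType) (T : topologicalType)
    (mu : set T -> \bar R) : set T :=
  [set x | forall U : set T, open U -> U x -> (0 < mu U)%E].

Record mmspace (R : realType) := MMSpace {
  mmcarrier :> pmetricType R ;
  mmcompact : compact [set: mmcarrier] ;
  mmmeasure : probability (borel mmcarrier) R ;
  mmfull_support : supp mmmeasure = [set: mmcarrier] }.

Section gromov_wasserstein.
Variable R : realType.
Implicit Types X Y : mmspace R.

Definition isomorphic X Y : Prop := exists f : X -> Y,
  [/\ bijective f,
      forall x x', mdist (f x) (f x') = mdist x x' &
      forall B : set (borel Y), measurable B ->
        pushforward (mmmeasure X) (f : borel X -> borel Y) B = mmmeasure Y B].

Definition isoclass :=
  {C : set (mmspace R) | exists X, C = [set Y | isomorphic X Y]}.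

Definition class_of X : isoclass :=
  exist _ [set Y | isomorphic X Y] (ex_intro _ X erefl).

(* The sigma-algebra on X * Y is the one generated by the open sets of the
   product topology. *)
Definition coupling X Y : set (probability (borel (X * Y)%type) R) :=
  [set gamma |
    (forall A : set (borel X), measurable A ->
       pushforward gamma (fst : borel (X * Y)%type -> borel X) A = mmmeasure X A) /\
    (forall B : set (borel Y), measurable B ->
       pushforward gamma (snd : borel (X * Y)%type -> borel Y) B = mmmeasure Y B)].
Arguments coupling : clear implicits.

Definition Lambda (q : \bar R) (a b : R) : R :=
  match q with
  | r%:E => `| a `^ r - b `^ r | `^ r^-1
  | +oo%E => if a == b then 0 else Num.max a b
  | -oo%E => 0 (* junk value *)
  end.

Definition dis (p q : \bar R) X Y
    (gamma : probability (borel (X * Y)%type) R) : \bar R :=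
  match p with
  | r%:E =>
    ((\int[gamma]_z' \int[gamma]_z
        ((Lambda q (mdist z.1 z'.1) (mdist z.2 z'.2)) `^ r)%:E) `^ r^-1)%E
  | +oo%E =>
    ereal_sup [set (Lambda q (mdist z.1 z'.1) (mdist z.2 z'.2))%:E
              | z in supp gamma & z' in supp gamma]
  | -oo%E => 0%E (* junk value *)
  end.

Definition dGW (p q : \bar R) X Y : \bar R :=
  ((2^-1)%:E * ereal_inf [set dis p q gamma | gamma in coupling X Y])%E.

End gromov_wasserstein.
Arguments coupling {R} X Y.

Definition is_metric (R : realType) (T : Type) (d : T -> T -> R) : Prop :=
  [/\ forall x y, 0 <= d x y,
      forall x y, d x y = 0 <-> x = y,
      forall x y, d x y = d y x &
      forall x y z, d x z <= d x y + d y z].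

(* Main.v *)
Require Import Defs.
From HB Require Import structures.
From mathcomp Require Import all_boot all_order all_algebra.
From mathcomp Require Import all_classical all_reals all_analysis.
From mathcomp Require Import measurable_realfun ess_sup_inf lra.
Import Order.TTheory GRing.Theory Num.Theory.
Import numFieldNormedType.Exports.

Set Implicit Arguments.
Unset Strict Implicit.
Unset Printing Implicit Defensive.

Local Open Scope classical_set_scope.
Local Open Scope ring_scope.

(** Everything is read on pairs of random variables. If f : Om -> X and
    g : Om -> Y are defined on a probability space (Om, P), their joint law is a
    coupling whose (p,q)-distortion is the Lp norm, on Om * Om, of the function
    (w', w) |-> Lambda q (d (f w) (f w')) (d (g w) (g w')) (dis_joint_law). For
    p = +oo this uses that Lambda is lower semicontinuous, so that a supremum
    over the support is an essential supremum. Monotonicity in q is then the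
    pointwise monotonicity of Lambda (Lambda_le) and monotonicity in p that of Lp
    norms on a probability space (Lnorm_le).

    Triangle inequality. Two couplings of (X, Y) and (Y, Z) are realized by three
    random variables on one probability space (gluing), where Minkowski's
    inequality and the triangle inequality for Lambda conclude (dis_gluing).
    An approximate gluing would not do, since Lambda +oo is discontinuous. The
    exact one resamples the X-coordinate given the Y-coordinate (randomization):
    X is a continuous image of the Cantor space, by a map with a Borel section,
    so it is enough to resample the binary digits of a code, and this is done by
    cutting the unit interval in proportion to Radon-Nikodym densities
    (random_code).

    Definiteness. By monotonicity it suffices to treat p = q = 1. If a
    coupling has small (1,1)-distortion, then most pairs (x, y) almost
    preserve the distances to most other pairs; as all balls of a given radius
    have measure bounded below, any two such pairs almost preserve their
    mutual distances (good_pairs_distortion). So there are relations of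
    distortion tending to 0 whose projections become dense and whose
    complements have vanishing mass (almost_isometry_exists). Their limit
    along an ultrafilter on the integers is a bijective isometry
    (limit_isometry_bijective), and comparing the measures of closed sets with
    those of their thickenings shows that it transports one measure to the
    other (limit_isometry_law). *)

(** * Monotonicity, triangle inequality and semicontinuity of Lambda *)

Arguments Lambda : simpl never.

Section Lambda.
Variable R : realType.
Implicit Types (a b c r s t : R) (q : \bar R).

Lemma ge1_ereal_cases q : (1 <= q)%E ->
  q = +oo%E \/ exists2 r, q = r%:E & 1 <= r.
Proof.
by case: q => [r r1| _ |]; [right; exists r; rewrite -?lee_fin|left|].
Qed.

Lemma powR_le_inv r a b : 0 < r -> 0 <= a -> 0 <= b ->
  a `^ r <= b `^ r -> a <= b.
Proof.
move=> r0 a0 b0; rewrite leNgt => h; rewrite leNgt; apply: contra h => ba.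
by apply: gt0_ltr_powR.
Qed.

(** Write u^s as u * u^(s-1) and bound the second factor by (a + b)^(s-1). *)
Lemma powR_superadditive s a b : 1 <= s -> 0 <= a -> 0 <= b ->
  a `^ s + b `^ s <= (a + b) `^ s.
Proof.
move=> s1 a0 b0; have s0 : 0 < s by rewrite (lt_le_trans _ s1).
rewrite -(mulr_powRB1 a0 s0) -(mulr_powRB1 b0 s0) -(mulr_powRB1 (addr_ge0 a0 b0) s0).
rewrite mulrDl lerD// ler_wpM2l// ge0_ler_powR ?nnegrE ?subr_ge0 ?addr_ge0//.
  by rewrite lerDl.
by rewrite lerDr.
Qed.

(** Superadditivity of the r-th power, read on r-th roots. *)
Lemma powR_subadditive r a b : 1 <= r -> 0 <= a -> 0 <= b ->
  (a + b) `^ r^-1 <= a `^ r^-1 + b `^ r^-1.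
Proof.
move=> r1 a0 b0; have r0 : 0 < r by rewrite (lt_le_trans _ r1).
apply: (powR_le_inv r0); rewrite ?addr_ge0 ?powR_ge0//.
have := powR_superadditive r1 (powR_ge0 a r^-1) (powR_ge0 b r^-1).
by apply: le_trans; rewrite -!powRrM mulVf ?gt_eqF// !powRr1// addr_ge0.
Qed.

Lemma Lambda_fin r a b : Lambda r%:E a b = `|a `^ r - b `^ r| `^ r^-1.
Proof. by []. Qed.

Lemma Lambda_pinfty a b : Lambda +oo a b = if a == b then 0 else Num.max a b.
Proof. by []. Qed.

Lemma Lambda_ge0 q a b : 0 <= a -> 0 <= Lambda q a b.
Proof.
case: q => [r||] a0 //; first by rewrite Lambda_fin powR_ge0.
by rewrite Lambda_pinfty; case: ifP => // _; rewrite le_max a0.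
Qed.

Lemma Lambda_sym q a b : Lambda q a b = Lambda q b a.
Proof.
case: q => [r||]; last by [].
- by rewrite !Lambda_fin distrC.
- by rewrite !Lambda_pinfty eq_sym maxC.
Qed.

Lemma Lambda_xx q a : (1 <= q)%E -> Lambda q a a = 0.
Proof.
case/ge1_ereal_cases => [->|[r -> r1]]; first by rewrite Lambda_pinfty eqxx.
by rewrite Lambda_fin subrr normr0 powR0// invr_eq0 gt_eqF// (lt_le_trans ltr01).
Qed.

Lemma Lambda_powK r a b : 0 < r -> Lambda r%:E a b `^ r = `|a `^ r - b `^ r|.
Proof. by move=> r0; rewrite Lambda_fin -powRrM mulVf ?gt_eqF// powRr1. Qed.

Lemma Lambda1 a b : 0 <= a -> 0 <= b -> Lambda 1 a b = `|a - b|.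
Proof. by move=> a0 b0; rewrite Lambda_fin invr1 !powRr1. Qed.

(** For finite q, subadditivity of the q-th root transfers the triangle
    inequality of |a^q - b^q|; for q = +oo, Lambda is even an ultrametric. *)
Lemma Lambda_triangle q a b c : (1 <= q)%E -> 0 <= a -> 0 <= b -> 0 <= c ->
  Lambda q a c <= Lambda q a b + Lambda q b c.
Proof.
move=> + a0 b0 c0; case/ge1_ereal_cases => [->|[r -> r1]]; last first.
  rewrite !Lambda_fin.
  apply: le_trans (powR_subadditive r1 (normr_ge0 _) (normr_ge0 _)).
  have r0 : 0 <= r^-1 by rewrite invr_ge0 (le_trans ler01).
  apply: (ge0_ler_powR r0); rewrite ?nnegrE ?addr_ge0//.
  by have := ler_normD (a `^ r - b `^ r) (b `^ r - c `^ r); rewrite subrKA.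
rewrite !Lambda_pinfty; have [->|ab] := eqVneq a b; first by rewrite add0r.
have [<-|bc] := eqVneq b c; first by rewrite addr0 (negbTE ab).
case: ifP => _; first by rewrite addr_ge0// le_max ?a0 ?b0.
rewrite ge_max; apply/andP; split.
  by rewrite -[leLHS]addr0 lerD// le_max ?lexx ?b0.
by rewrite -[leLHS]add0r lerD// le_max ?lexx ?a0 ?orbT.
Qed.

Lemma Lambda_le_max q a b : (1 <= q)%E -> 0 <= a -> 0 <= b ->
  Lambda q a b <= Num.max a b.
Proof.
move=> q1; wlog ab : a b / b <= a => [h a0 b0|a0 b0].
  have [ba|ab] := orP (le_total b a); first exact: h.
  by rewrite Lambda_sym maxC; exact: h.
have [->|[r -> r1]] := ge1_ereal_cases q1.
  by rewrite Lambda_pinfty; case: ifP => // _; rewrite le_max a0.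
have r0 : 0 < r by rewrite (lt_le_trans _ r1).
rewrite (max_idPl ab); apply: (powR_le_inv r0 (Lambda_ge0 _ _ a0) a0).
rewrite Lambda_powK// ger0_norm ?subr_ge0.
  by rewrite gerBl powR_ge0.
by rewrite ge0_ler_powR// ltW.
Qed.

(** Let b <= a and L = Lambda q a b, so that a^q = L^q + b^q. The power
    q'/q >= 1 is superadditive, hence L^q' + b^q' <= a^q'. *)
Lemma Lambda_le q q' a b : (1 <= q)%E -> (q <= q')%E -> 0 <= a -> 0 <= b ->
  Lambda q a b <= Lambda q' a b.
Proof.
move=> q1 qq'; wlog ab : a b / b <= a => [h a0 b0|a0 b0].
  have [ba|ab] := orP (le_total b a); first exact: h.
  by rewrite (Lambda_sym q) (Lambda_sym q'); exact: h.
have [qE|[s qE s1]] := ge1_ereal_cases (le_trans q1 qq'); rewrite {}qE in qq' *.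
  have [->|ne] := eqVneq a b; first by rewrite !Lambda_xx ?leey.
  by rewrite Lambda_pinfty (negbTE ne); exact: Lambda_le_max.
have [qE|[r qE r1]] := ge1_ereal_cases q1; rewrite {}qE in qq' *.
  by rewrite leye_eq in qq'.
rewrite lee_fin in qq'; rename qq' into rs.
have r0 : 0 < r by rewrite (lt_le_trans _ r1).
have s0 : 0 < s by rewrite (lt_le_trans _ rs).
apply: (powR_le_inv s0 (Lambda_ge0 _ _ a0) (Lambda_ge0 _ _ a0)).
rewrite [leRHS]Lambda_powK//.
rewrite ger0_norm ?subr_ge0 ?ge0_ler_powR ?nnegrE ?(ltW s0)//.
have brar : b `^ r <= a `^ r by rewrite ge0_ler_powR ?nnegrE ?(ltW r0).
rewrite lerBrDr; have sr1 : 1 <= s / r by rewrite ler_pdivlMr// mul1r.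
have powRE u : u `^ s = (u `^ r) `^ (s / r).
  by rewrite -powRrM mulrC divfK// gt_eqF.
rewrite !powRE Lambda_powK// ger0_norm ?subr_ge0//.
have D0 : 0 <= a `^ r - b `^ r by rewrite subr_ge0.
have := powR_superadditive sr1 D0 (powR_ge0 b r).
by rewrite subrK.
Qed.

(** Lambda increases with q, and at a natural exponent n its n-th power is the
    continuous function |a^n - b^n|. *)
Lemma Lambda_near q a e : (1 <= q)%E -> q != +oo%E -> 0 <= a -> 0 < e ->
  exists2 d, 0 < d &
    forall b, 0 <= b -> `|a - b| < d -> Lambda q a b < e.
Proof.
case/ge1_ereal_cases => [->|[r -> r1] _ a0 e0]; first by rewrite eqxx.
have [n rn] : exists n : nat, r <= n%:R.
  by exists (Num.truncn r).+1; rewrite ltW// truncnS_gt.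
have n1 : 1 <= n%:R :> R by rewrite (le_trans r1).
have n0 : 0 < n%:R :> R by rewrite (lt_le_trans _ n1).
have := @exprn_continuous R n a.
move=> /cvgrPdist_lt /(_ (e ^+ n)) /(_ (exprn_gt0 _ e0)).
move=> /nbhs_ballP[d /= d0 ball_d]; exists d => // b b0 abd.
apply: (@le_lt_trans _ _ (Lambda n%:R%:E a b)).
  by apply: Lambda_le; rewrite ?lee_fin.
rewrite ltNge; apply/negP => h.
have : e `^ n%:R <= Lambda n%:R%:E a b `^ n%:R.
  by rewrite ge0_ler_powR ?nnegrE ?Lambda_ge0 ?(ltW e0) ?(ltW n0).
rewrite Lambda_powK// !powR_mulrn ?(ltW e0)// leNgt => /negP; apply.
exact: ball_d.
Qed.

(** Lower semicontinuity is what remains at q = +oo, where Lambda jumps to 0 on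
    the diagonal: a strict superlevel set is the open set where the arguments
    differ and their maximum exceeds the level. For finite q, the triangle
    inequality deduces it from continuity at the diagonal. *)
Lemma Lambda_lsc q a b t : (1 <= q)%E -> 0 <= a -> 0 <= b -> 0 <= t ->
  t < Lambda q a b -> exists2 d, 0 < d & forall a' b',
    0 <= a' -> 0 <= b' -> `|a - a'| < d -> `|b - b'| < d -> t < Lambda q a' b'.
Proof.
move=> q1 a0 b0 t0; have [->|qoo] := eqVneq q +oo%E.
  rewrite Lambda_pinfty; case: ifPn => [_|ab]; first by rewrite ltNge t0.
  move=> tab; have m0 : 0 < Num.min (`|a - b| / 2) (Num.max a b - t).
    by rewrite lt_min subr_gt0 tab divr_gt0// normr_gt0 subr_eq0 ab.
  exists (Num.min (`|a - b| / 2) (Num.max a b - t)) => // a' b' a'0 b'0.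
  rewrite Lambda_pinfty !lt_min => /andP[aa1 aa2] /andP[bb1 bb2].
  case: ifPn => [/eqP a'b'|_].
    exfalso; move: aa1 bb1; rewrite -a'b'.
    have := ler_normD (a - a') (a' - b); rewrite subrKA (distrC a' b).
    by move=> h1 h2 h3; clear -h1 h2 h3; lra.
  have [ba|ab'] := orP (le_total b a).
    rewrite lt_max; apply/orP; left; move: aa2; rewrite (max_idPl ba).
    by have := ler_norm (a - a'); clear; lra.
  rewrite lt_max; apply/orP; right; move: bb2; rewrite (max_idPr ab').
  by have := ler_norm (b - b'); clear; lra.
move=> tL; pose e := (Lambda q a b - t) / 2.
have e0 : 0 < e by rewrite divr_gt0// subr_gt0.
have [d1 d10 h1] := Lambda_near q1 qoo a0 e0.
have [d2 d20 h2] := Lambda_near q1 qoo b0 e0.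
exists (Num.min d1 d2); first by rewrite lt_min d10.
move=> a' b' a'0 b'0; rewrite !lt_min => /andP[aa _] /andP[_ bb].
have := Lambda_triangle q1 a0 a'0 b0.
have := Lambda_triangle q1 a'0 b'0 b0.
have := h1 _ a'0 aa; have := h2 _ b'0 bb; rewrite (Lambda_sym q b b') /e.
by clear; lra.
Qed.

Lemma measurable_Lambda q : measurable_fun [set: R * R] (fun u => Lambda q u.1 u.2).
Proof.
case: q => [r||] /=.
- apply: (@measurableT_comp _ _ _ _ _ _ (@powR R ^~ r^-1)) => //.
  apply: measurableT_comp => //; apply: measurable_funB.
    by apply: (@measurableT_comp _ _ _ _ _ _ (@powR R ^~ r)).
  by apply: (@measurableT_comp _ _ _ _ _ _ (@powR R ^~ r)).
- apply: measurable_fun_ifT => //.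
    exact: measurable_fun_eqr.
  exact: measurable_maxr.
- exact: measurable_cst.
Qed.

End Lambda.

(** * Borel sets of second countable spaces and of compact metric spaces *)

Notation borel_fun f := (@measurable_fun _ _ _ (borel _) setT f).

HB.instance Definition _ (S T : ptopologicalType) := Pointed.on (S * T)%type.

Section borel.

Lemma countable_bigcup_seq T (B : set (set T)) : countable B ->
  exists2 F : nat -> set T, forall n, B (F n) \/ F n = set0 &
    \bigcup_(U in B) U = \bigcup_n F n.
Proof.
case/countable_injP => f finj.
exists (fun n => \bigcup_(U in [set U | B U /\ f U = n]) U).
  move=> n; have [[U [BU fUn]]|nU] := pselect (exists U, B U /\ f U = n).
    left; suff -> : [set U | B U /\ f U = n] = [set U] by rewrite bigcup_set1.
    apply/seteqP; split => [V [BV fV]|V ->//].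
    by apply: finj; rewrite ?inE// fV fUn.
  by right; apply/seteqP; split => // x [U /= h _]; apply: nU; exists U.
apply/seteqP; split => [x [U BU Ux]|x [n _ [U [BU _] Ux]]]; last by exists U.
by exists (f U) => //; exists U.
Qed.

Lemma open_borel (T : ptopologicalType) (A : set T) :
  open A -> measurable (A : set (borel T)).
Proof. by move=> oA; exact: sub_sigma_algebra. Qed.

Lemma closed_borel (T : ptopologicalType) (A : set T) :
  closed A -> measurable (A : set (borel T)).
Proof.
move=> cA; rewrite -[A]setCK; apply: measurableC.
by apply: open_borel; exact: closed_openC.
Qed.

Lemma borel_funP d (Om : measurableType d) (T : ptopologicalType) (f : Om -> T) :
  (forall O : set T, open O -> measurable (f @^-1` O)) -> borel_fun f.
Proof.
move=> h; apply: (@measurability _ _ _ (borel T) _ _ (@open T)) => //.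
by move=> _ [U oU <-]; rewrite setTI; exact: h.
Qed.

Lemma borel_fun_open d (Om : measurableType d) (T : ptopologicalType)
    (f : Om -> T) (O : set T) :
  borel_fun f -> open O -> measurable (f @^-1` O).
Proof. by move=> mf oO; rewrite -[X in measurable X]setTI; apply: mf => //; exact: open_borel. Qed.

Lemma continuous_borel_fun (S T : ptopologicalType) (f : S -> T) :
  continuous f -> borel_fun (f : borel S -> T).
Proof.
move=> cf; apply: borel_funP => O oO; apply: open_borel.
by apply: open_comp => // x _; exact: cf.
Qed.

Lemma open_basis_bigcup (T : topologicalType) (B : set (set T)) (O : set T) :
  basis B -> open O -> O = \bigcup_(U in [set U | B U /\ U `<=` O]) U.
Proof.
move=> [Bo Bb] oO; apply/seteqP; split => [x Ox|x [U [_ UO]]]; last exact: UO.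
have /Bb[U [BU Ux] UO] : nbhs x O by exact: open_nbhs_nbhs.
by exists U.
Qed.

Lemma borel_fun_basis d (Om : measurableType d)
    (T : ptopologicalType) (f : Om -> T) (B : set (set T)) :
  countable B -> basis B -> (forall U, B U -> measurable (f @^-1` U)) ->
  borel_fun f.
Proof.
move=> cB Bb mf; apply: borel_funP => O oO.
rewrite (open_basis_bigcup Bb oO).
have [|F BF ->] := @countable_bigcup_seq _ [set U | B U /\ U `<=` O].
  by apply: sub_countable cB; apply: subset_card_le => U [].
rewrite preimage_bigcup; apply: bigcupT_measurable => n.
by have [[BU _]|->] := BF n; [exact: mf|rewrite preimage_set0].
Qed.

Lemma second_countable_prod (S T : topologicalType) (A : set (set S))
    (B : set (set T)) : basis A -> basis B ->
  basis [set U.1 `*` U.2 | U in A `*` B].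
Proof.
move=> [Ao Ab] [Bo Bb]; split.
  move=> _ [[U V] [/= AU BV] <-]; rewrite openE => -[x y] [/= Ux Vy].
  by exists (U, V) => //; split; apply: open_nbhs_nbhs; split => //;
    [exact: Ao|exact: Bo].
move=> [x y] W [[U V] /= [/Ab[U' [AU' U'x] U'U] /Bb[V' [BV' V'y] V'V]] UVW].
exists (U' `*` V'); first by split=> //; exists (U', V').
by move=> [x' y'] [/= /U'U ? /V'V ?]; exact: UVW.
Qed.

(** A countable basis of open rectangles makes every Borel set of the product
    measurable for the product of the Borel sigma-algebras. *)
Lemma borel_fun_pair d (Om : measurableType d) (S T : ptopologicalType)
    (f : Om -> S) (g : Om -> T) :
  @second_countable S -> @second_countable T ->
  borel_fun f -> borel_fun g ->
  @measurable_fun _ _ Om (borel (S * T)%type) setT (fun w => (f w, g w)).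
Proof.
move=> [A cA Ab] [B cB Bb] mf mg.
apply: (borel_fun_basis _ (second_countable_prod Ab Bb)).
  exact: sub_countable (card_image_le _ _) (countableX cA cB).
move=> _ [[U V] [/= AU BV] <-].
rewrite (_ : _ @^-1` _ = f @^-1` U `&` g @^-1` V)//.
by apply: measurableI; apply: borel_fun_open => //; [apply: Ab.1|apply: Bb.1].
Qed.

Lemma setC_supp (R : realType) (T : ptopologicalType)
    (mu : {measure set (borel T) -> \bar R}) :
  ~` supp mu = \bigcup_(U in [set U : set T | open U /\ mu U = 0%E]) U.
Proof.
apply/seteqP; split=> [x nx|x [U [oU U0] Ux] /(_ _ oU Ux)]; last first.
  by rewrite U0 ltxx.
apply: contrapT => h; apply: nx => U oU Ux; rewrite lt0e measure_ge0 andbT.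
by apply/eqP => U0; apply: h; exists U.
Qed.

Lemma closed_supp (R : realType) (T : ptopologicalType)
    (mu : {measure set (borel T) -> \bar R}) : closed (supp mu).
Proof.
by rewrite -[supp mu]setCK; apply: open_closedC; rewrite setC_supp;
  apply: bigcup_open => U [].
Qed.

(** The complement of the support is a union of null open sets, which a
    countable basis makes countable. *)
Lemma measure_setC_supp (R : realType) (T : ptopologicalType)
    (mu : {measure set (borel T) -> \bar R}) :
  @second_countable T -> mu (~` supp mu) = 0%E.
Proof.
move=> [B cB Bb]; pose B0 := [set U | B U /\ mu U = 0%E].
have -> : ~` supp mu = \bigcup_(U in B0) U.
  rewrite setC_supp; apply/seteqP; split => [x [U [oU U0] Ux]|]; last first.
    by move=> x [U [BU U0] Ux]; exists U => //; split => //; exact: Bb.1.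
  rewrite (open_basis_bigcup Bb oU) in Ux; case: Ux => V [BV VU] Vx.
  exists V => //; split => //; apply/eqP; rewrite -measure_le0 -U0.
  by apply: le_measure; rewrite ?inE //; apply: open_borel => //; exact: Bb.1.
have [|F BF ->] := @countable_bigcup_seq _ B0.
  by apply: sub_countable cB; apply: subset_card_le => U [].
have F0 n : mu.-negligible (F n).
  have [[BU U0]|->] := BF n; last exact: negligible_set0.
  by apply/negligibleP => //; apply: open_borel; exact: Bb.1.
apply: measure_negligible; last exact: negligible_bigcup.
apply: bigcupT_measurable => n; have [[BU _]|->] := BF n => //.
by apply: open_borel; exact: Bb.1.
Qed.

End borel.

Section metric.
Variable R : realType.

Lemma compact_borel_fun_pair d (Om : measurableType d) (X Y : pmetricType R)
    (f : Om -> X) (g : Om -> Y) :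
  compact [set: X] -> compact [set: Y] -> borel_fun f -> borel_fun g ->
  @measurable_fun _ _ Om (borel (X * Y)%type) setT (fun w => (f w, g w)).
Proof. by move=> cX cY; apply: borel_fun_pair; apply: compact_second_countable. Qed.

Lemma second_countable_compactX (X Y : pmetricType R) :
  compact [set: X] -> compact [set: Y] -> @second_countable (X * Y)%type.
Proof.
move=> /compact_second_countable[A cA Ab] /compact_second_countable[B cB Bb].
exists [set U.1 `*` U.2 | U in A `*` B]; last exact: second_countable_prod.
exact: sub_countable (card_image_le _ _) (countableX cA cB).
Qed.

Lemma mdist_lipschitz (X : metricType R) (x x' y y' : X) :
  `|mdist x y - mdist x' y'| <= mdist x x' + mdist y y'.
Proof.
rewrite ler_norml lerBlDr lerBrDr; apply/andP; split.
  have h1 := metric_triangle x' x y'; have h2 := metric_triangle x y y'.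
  by rewrite (metric_sym x' x) in h1; lra.
have h1 := metric_triangle x x' y; have h2 := metric_triangle x' y' y.
by rewrite (metric_sym y' y) in h2; lra.
Qed.

Lemma continuous_mdist (X : metricType R) :
  continuous (fun u : X * X => mdist u.1 u.2).
Proof.
move=> [x y]; apply/cvgrPdist_lt => e e0; have e20 : 0 < e / 2 by rewrite divr_gt0.
exists (ball x (e / 2), ball y (e / 2)) => /=.
  by split; apply: nbhsx_ballx.
move=> [x' y'] [/=]; rewrite !ballEmdist /= => xx' yy'.
by rewrite (le_lt_trans (mdist_lipschitz _ _ _ _))// (splitr e) ltrD.
Qed.

Lemma measurable_mdist d (Om : measurableType d) (X : pmetricType R)
    (f g : Om -> X) : compact [set: X] -> borel_fun f -> borel_fun g ->
  measurable_fun setT (fun w => mdist (f w) (g w)).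
Proof.
move=> cX mf mg; apply: (measurability _ (RGenOInfty.measurableE R)).
move=> _ [_ [a ->] <-]; rewrite setTI preimage_itvoy.
rewrite (_ : [set _ | _] = (fun w => (f w, g w)) @^-1` [set u : X * X | a < mdist u.1 u.2])//.
apply: borel_fun_open; first exact: compact_borel_fun_pair.
apply: (@open_comp _ _ (fun u : X * X => mdist u.1 u.2) [set r | a < r]).
  by move=> u _; exact: continuous_mdist.
exact: open_gt.
Qed.

Lemma compact_mdist_bounded (X : pmetricType R) : compact [set: X] ->
  exists D : R, forall x y : X, mdist x y <= D.
Proof.
move=> cX; have /compact_bounded : compact ((mdist (point : X)) @` [set: X]).
  apply: continuous_compact => //; apply: continuous_subspaceT => x.
  apply: (@continuous_comp _ _ _ (fun y => (point, y)) (fun u : X * X => mdist u.1 u.2)).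
    by apply: cvg_pair; [exact: cvg_cst|exact: cvg_id].
  exact: continuous_mdist.
move=> [M [_ /(_ (M + 1))]]; rewrite ltrDl ltr01 => /(_ isT) MD.
have D0 (x : X) : mdist point x <= M + 1.
  by rewrite (le_trans (ler_norm _))//; apply: MD; exists x.
exists (M + 1 + (M + 1)) => x y; rewrite (le_trans (metric_triangle x point y))// lerD//.
by rewrite metric_sym.
Qed.

End metric.

(** * Distortion of a pair of random variables *)

Section distortion.
Context {R : realType} d {Om : measurableType d} {X Y : mmspace R}.
Variables (P : probability Om R) (f : Om -> X) (g : Om -> Y).
Hypotheses (mf : @measurable_fun _ _ Om (borel X) setT f)
           (mg : @measurable_fun _ _ Om (borel Y) setT g).

(** The pair u lists the outer integration variable of dis first. *)
Definition distortion (q : \bar R) (u : Om * Om) : R :=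
  Lambda q (mdist (f u.2) (f u.1)) (mdist (g u.2) (g u.1)).

Lemma distortion_ge0 q u : 0 <= distortion q u.
Proof. by apply: Lambda_ge0; exact: mdist_ge0. Qed.

Lemma measurable_distortion q : measurable_fun setT (distortion q).
Proof.
have mfg : measurable_fun setT
    (fun u : Om * Om => (mdist (f u.2) (f u.1), mdist (g u.2) (g u.1))).
  apply: measurable_fun_pair; apply: measurable_mdist; try exact: mmcompact.
  - exact: (measurableT_comp mf).
  - exact: (measurableT_comp mf).
  - exact: (measurableT_comp mg).
  - exact: (measurableT_comp mg).
exact: (measurableT_comp (measurable_Lambda q) mfg).
Qed.

Let fg w : (X * Y)%type := (f w, g w).

Lemma measurable_fun_fg : @measurable_fun _ _ Om (borel (X * Y)%type) setT fg.
Proof. by apply: compact_borel_fun_pair => //; exact: mmcompact. Qed.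

Definition joint_law : probability (borel (X * Y)%type) R :=
  distribution P (mfun_Sub (mem_set measurable_fun_fg)).

Lemma joint_lawE A : joint_law A = P (fg @^-1` A).
Proof. by []. Qed.

Lemma integral_joint_law (h : X * Y -> \bar R) :
  @measurable_fun _ _ (borel (X * Y)%type) _ setT h -> (forall z, 0 <= h z)%E ->
  (\int[joint_law]_z h z = \int[P]_w h (f w, g w))%E.
Proof.
move=> mh h0.
by rewrite ge0_integral_pushforward //; exact: measurable_fun_fg.
Qed.

End distortion.

Lemma measurable_borel_fst (R : realType) (X Y : mmspace R) :
  @measurable_fun _ _ (borel (X * Y)%type) (borel X) setT fst.
Proof.
by apply: (@continuous_borel_fun (X * Y)%type X) => z; exact: cvg_fst.
Qed.

Lemma measurable_borel_snd (R : realType) (X Y : mmspace R) :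
  @measurable_fun _ _ (borel (X * Y)%type) (borel Y) setT snd.
Proof.
by apply: (@continuous_borel_fun (X * Y)%type Y) => z; exact: cvg_snd.
Qed.

Section dis_joint_law.
Context {R : realType} d {Om : measurableType d} {X Y : mmspace R}.
Variables (P : probability Om R) (f : Om -> X) (g : Om -> Y).
Hypotheses (mf : @measurable_fun _ _ Om (borel X) setT f)
           (mg : @measurable_fun _ _ Om (borel Y) setT g).
Local Open Scope ereal_scope.

Lemma dis_joint_law_fin q r : (1 <= r)%R ->
  dis r%:E q (joint_law P mf mg) = 'N[(P \x P)%E]_(r%:E)[EFin \o distortion f g q].
Proof.
move=> r1; rewrite unlock /dis; congr (_ `^ _).
set J := joint_law _ _ _.
have mpow d' (Om' : measurableType d') (h : Om' -> R) : measurable_fun setT h ->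
    measurable_fun setT (fun w => (h w `^ r)%:E).
  move=> mh; apply/measurable_EFinP.
  exact: (@measurableT_comp _ _ _ _ _ _ (@powR R ^~ r)).
pose D (u : borel (X * Y)%type * borel (X * Y)%type) : \bar R :=
  (distortion (fst : borel (X * Y)%type -> X) (snd : borel (X * Y)%type -> Y) q u `^ r)%:E.
have mD : measurable_fun setT D.
  by apply: mpow; apply: measurable_distortion;
    [exact: measurable_borel_fst|exact: measurable_borel_snd].
have D0 u : 0 <= D u by rewrite lee_fin powR_ge0.
transitivity (\int[J]_z' \int[J]_z D (z', z)); first by [].
rewrite integral_joint_law; last 2 first.
- exact (measurable_fun_fubini_tonelli_F (m2 := J) D mD D0).
- by move=> z'; apply: integral_ge0.
transitivity (\int[P]_w' \int[P]_w (distortion f g q (w', w) `^ r)%:E).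
  apply: eq_integral => w' _; rewrite integral_joint_law//.
  exact: measurable_fun_pair2.
rewrite -(fubini_tonelli1 (fun u => (distortion f g q u `^ r)%:E)) //.
- by apply: eq_integral => u _ /=; rewrite ger0_norm// distortion_ge0.
- by apply: mpow; exact: measurable_distortion.
- by move=> u; rewrite lee_fin powR_ge0.
Qed.

Lemma measure_setC_supp_joint_law : joint_law P mf mg (~` supp (joint_law P mf mg)) = 0.
Proof.
by apply: (@measure_setC_supp R (X * Y)%type);
  apply: second_countable_compactX; exact: mmcompact.
Qed.

Let product_open_gt0 (U V : set (X * Y)) : open U -> open V ->
  0 < joint_law P mf mg U -> 0 < joint_law P mf mg V ->
  0 < (P \x P)%E ([set w | U (f w, g w)] `*` [set w | V (f w, g w)]).
Proof.
move=> oU oV U0 V0; have m (W : set (X * Y)) : open W ->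
    measurable [set w | W (f w, g w)].
  by move=> oW; exact: (borel_fun_open (measurable_fun_fg mf mg)).
by rewrite product_measure1E; [exact: mule_gt0|exact: m|exact: m].
Qed.

(** The support has full measure, which bounds the essential supremum by the
    supremum; conversely, by lower semicontinuity, any level below the value at a
    pair of points of the support is exceeded on a neighbourhood of that pair,
    which has positive measure. *)
Lemma dis_joint_law_pinfty q : (1 <= q) ->
  dis +oo q (joint_law P mf mg) = 'N[(P \x P)%E]_(+oo)[EFin \o distortion f g q].
Proof.
move=> q1; have PP_gt0 : 0 < (P \x P) [set: Om * Om].
  have P_gt0 : 0 < P [set: Om] by rewrite probability_setT lte01.
  by rewrite -setXTT product_measure1E//; exact: mule_gt0.
rewrite unlock /dis ifT; last exact: PP_gt0.
set J := joint_law P mf mg; set I := [set _ | _ in _ & _ in _].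
have absD u : (abse \o (EFin \o distortion f g q)) u = (distortion f g q u)%:E.
  by rewrite /= ger0_norm// distortion_ge0.
apply/eqP; rewrite eq_le; apply/andP; split.
  apply: ge_ereal_sup => _ [[x y] Sxy [[x' y'] Sxy' <-]] /=.
  set D := ess_sup _ _; rewrite leNgt; apply/negP => DL.
  have D0 : 0 <= D.
    apply: ess_sup_gee; first exact: PP_gt0.
    by apply: nearW => u; rewrite absD lee_fin distortion_ge0.
  have [t Dt] : exists t, D = t%:E.
    by move: D D0 DL => [t||] //; exists t.
  have /ess_supP := le_refl D; rewrite {}Dt lte_fin in DL D0 *.
  rewrite lee_fin in D0.
  have [e e0 near_L] := Lambda_lsc q1 (mdist_ge0 x x') (mdist_ge0 y y') D0 DL.
  pose U z : set (X * Y) := (ball z (e / 2))°.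
  have e20 : (0 < e / 2)%R by rewrite divr_gt0.
  have oU z : open (U z) by exact: open_interior.
  have Uz z : U z z by apply: nbhsx_ballx.
  have := product_open_gt0 (oU (x', y')) (oU (x, y)) (Sxy' _ (oU _) (Uz _))
    (Sxy _ (oU _) (Uz _)).
  set C := _ `*` _ => C0 aeD.
  suff C_negl : (P \x P).-negligible C.
    have mC : measurable C.
      by apply: measurableX; apply: (borel_fun_open (measurable_fun_fg mf mg)).
    by move: C0; rewrite (measure_negligible mC C_negl) ltxx.
  apply: negligibleS aeD => u [/= /interior_subset [/=]]; rewrite !ballEmdist /=.
  move=> x'f y'g /interior_subset [/=]; rewrite !ballEmdist /= => xf yg.
  rewrite /= ger0_norm ?distortion_ge0// lee_fin; apply/negP; rewrite -ltNge.
  apply: near_L; rewrite ?mdist_ge0//.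
  - by rewrite (le_lt_trans (mdist_lipschitz _ _ _ _))// (splitr e) ltrD.
  - by rewrite (le_lt_trans (mdist_lipschitz _ _ _ _))// (splitr e) ltrD.
apply/ess_supP.
pose S := [set w | supp J (f w, g w)].
have mS : measurable S.
  have := @closed_borel (X * Y)%type _ (@closed_supp R (X * Y)%type J).
  by move/(measurable_fun_fg mf mg measurableT); rewrite setTI.
have PS : P (~` S) = 0 by exact: measure_setC_supp_joint_law.
have negl (A : set (Om * Om)) : measurable A -> (P \x P) A = 0 ->
    (P \x P).-negligible A by move=> mA A0; apply/negligibleP.
apply: (@negligibleS _ _ _ _ ((~` S `*` setT) `|` (setT `*` ~` S))).
  move=> [w' w] /= nle; apply: contrapT => /not_orP[nw' nw]; apply: nle.
  have {}nw' : S w' by apply: contrapT => h; apply: nw'.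
  have {}nw : S w by apply: contrapT => h; apply: nw.
  rewrite ger0_norm ?distortion_ge0//; apply: ereal_sup_ubound.
  by exists (f w, g w) => //; exists (f w', g w').
have mCS : measurable (~` S) by exact: measurableC.
apply: negligibleU; apply: negl.
- exact: measurableX.
- by rewrite product_measure1E// [X in X * _](_ : _ = 0) ?mul0e//; exact: PS.
- exact: measurableX.
- by rewrite product_measure1E// [X in _ * X](_ : _ = 0) ?mule0//; exact: PS.
Qed.

Lemma dis_joint_law p q : 1 <= p -> 1 <= q ->
  dis p q (joint_law P mf mg) = 'N[(P \x P)%E]_p[EFin \o distortion f g q].
Proof.
case/ge1_ereal_cases => [->|[r -> r1]] q1; first exact: dis_joint_law_pinfty.
exact: dis_joint_law_fin.
Qed.

End dis_joint_law.

(** * Lp norms on a probability space *)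

Section Lnorm.
Context d (T : measurableType d) (R : realType) (P : probability T R).
Local Open Scope ereal_scope.
Implicit Types (f g : T -> R) (p : \bar R).

Lemma measurable_normr_powR f r : measurable_fun setT f ->
  measurable_fun setT (fun x => `|f x| `^ r)%R.
Proof.
move=> mf; apply: (@measurableT_comp _ _ _ _ _ _ (@powR R ^~ r)) => //.
exact: measurableT_comp.
Qed.

Lemma le_Lnorm_fun p f g : 1 <= p ->
  measurable_fun setT f -> measurable_fun setT g ->
  (forall x, `|f x| <= `|g x|)%R -> 'N[P]_p[EFin \o f] <= 'N[P]_p[EFin \o g].
Proof.
move=> + mf mg fg; case/ge1_ereal_cases => [->|[r -> r1]]; rewrite unlock /Lnorm.
  case: ifP => // _; apply: le_ess_sup; apply: nearW => x /=.
  by rewrite lee_fin.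
have r0 : (0 <= r)%R by rewrite (le_trans ler01).
apply: gt0_ler_poweR; first by rewrite invr_ge0.
- by rewrite in_itv /= leey andbT integral_ge0.
- by rewrite in_itv /= leey andbT integral_ge0.
apply: ge0_le_integral => //=.
- exact/measurable_EFinP/measurable_normr_powR.
- exact/measurable_EFinP/measurable_normr_powR.
- by move=> x _; rewrite lee_fin ge0_ler_powR.
Qed.

Lemma Lnorm_le_pinfty r f : (1 <= r)%R -> measurable_fun setT f ->
  'N[P]_(r%:E)[EFin \o f] <= 'N[P]_(+oo)[EFin \o f].
Proof.
move=> r1 mf; have r0 : (0 < r)%R by rewrite (lt_le_trans ltr01).
have P_gt0 : 0 < P [set: T] by rewrite probability_setT lte01.
have : 0 <= 'N[P]_(+oo)[EFin \o f] by exact: Lnorm_ge0.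
have : \forall x \ae P, (abse \o (EFin \o f)) x <= 'N[P]_(+oo)[EFin \o f].
  by rewrite unlock /Lnorm ifT//; exact: ess_sup_ge.
case: 'N[P]_(+oo)[EFin \o f] => [M||] //; last by move=> _ _; rewrite leey.
rewrite lee_fin => fM M0; rewrite unlock.
have -> : M%:E = (M `^ r)%:E `^ r^-1.
  by rewrite poweR_EFin -powRrM divff ?gt_eqF// powRr1.
apply: gt0_ler_poweR; first by rewrite invr_ge0 ltW.
- by rewrite in_itv /= leey andbT integral_ge0.
- by rewrite in_itv /= leey andbT lee_fin powR_ge0.
have -> : (M `^ r)%:E = \int[P]_x (M `^ r)%:E.
  rewrite integral_cst// [X in _ * X](_ : _ = 1) ?mule1//.
  exact: probability_setT.
apply: ae_ge0_le_integral => //=.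
- exact/measurable_EFinP/measurable_normr_powR.
- by move=> x _; rewrite lee_fin powR_ge0.
- apply: filterS fM => x /= fxM _; rewrite lee_fin ge0_ler_powR ?(ltW r0)//.
Qed.

(** Hoelder's inequality for |f|^r and the constant function 1, with exponent
    s / r. *)
Lemma Lnorm_le_fin r s f : (1 <= r)%R -> (r <= s)%R -> measurable_fun setT f ->
  'N[P]_(r%:E)[EFin \o f] <= 'N[P]_(s%:E)[EFin \o f].
Proof.
move=> r1; rewrite le_eqVlt => /predU1P[->//|rs] mf.
have r0 : (0 < r)%R by rewrite (lt_le_trans ltr01).
have s0 : (0 < s)%R by rewrite (lt_trans r0).
pose t := (s / r)%R; pose t' := (1 - t^-1)^-1%R.
have t0 : (0 < t)%R by rewrite divr_gt0.
have t'0 : (0 < t')%R.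
  by rewrite invr_gt0 subr_gt0 invf_lt1// ltr_pdivlMr// mul1r.
have tt' : (t^-1 + t'^-1 = 1)%R by rewrite invrK subrKC.
have := hoelder P (measurable_normr_powR r mf) (measurable_cst (1%R : R)) t0 t'0 tt'.
rewrite Lnorm_cst1 [X in X `^ _](_ : _ = 1) ?poweR1r ?mule1; last exact: probability_setT.
under [X in X <= _]eq_Lnorm do rewrite /= mulr1.
rewrite Lnorm1 unlock => h.
have I0 u : 0 <= \int[P]_x `|(EFin \o f) x| `^ u by apply: integral_ge0 => x _; exact: poweR_ge0.
apply: (@le_trans _ _ ((\int[P]_x `|(EFin \o f) x| `^ s) `^ t^-1 `^ r^-1)); last first.
  by rewrite -poweRrM /t invf_div mulrAC divff ?gt_eqF// mul1r.
apply: gt0_ler_poweR; first by rewrite invr_ge0 ltW.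
- by rewrite in_itv /= leey andbT I0.
- by rewrite in_itv /= leey andbT poweR_ge0.
move: h; congr (_ <= _ `^ _).
- by apply: eq_integral => x _ /=; rewrite ger0_norm ?powR_ge0.
- apply: eq_integral => x _ /=; rewrite ger0_norm ?powR_ge0//.
  by rewrite -powRrM /t mulrC divfK// gt_eqF.
Qed.

Lemma Lnorm_le p p' f : 1 <= p -> p <= p' -> measurable_fun setT f ->
  'N[P]_p[EFin \o f] <= 'N[P]_p'[EFin \o f].
Proof.
move=> p1 pp' mf; have p'1 := le_trans p1 pp'.
have [pE|[r pE r1]] := ge1_ereal_cases p1; rewrite {}pE in pp' *.
  by move: pp'; rewrite leye_eq => /eqP ->.
have [p'E|[s p'E s1]] := ge1_ereal_cases p'1; rewrite {}p'E in pp' *.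
  exact: Lnorm_le_pinfty.
by apply: Lnorm_le_fin => //; rewrite lee_fin in pp'.
Qed.

Lemma Lnorm_le_bound p f (D : R) : 1 <= p -> measurable_fun setT f ->
  (forall x, `|f x| <= D)%R -> 'N[P]_p[EFin \o f] <= D%:E.
Proof.
move=> p1 mf fD; apply: (le_trans (Lnorm_le p1 (leey _) mf)).
have P_gt0 : 0 < P [set: T] by rewrite probability_setT lte01.
rewrite unlock /Lnorm ifT//.
by apply/ess_supP; apply: nearW => x /=; rewrite lee_fin.
Qed.

End Lnorm.

(** * Binary coding of compact metric spaces *)

(** Words store the most recent digit first, so that cons extends a word. *)
Fixpoint prefix (n : nat) (x : nat -> bool) : seq bool :=
  if n is m.+1 then x m :: prefix m x else [::].

Lemma size_prefix n x : size (prefix n x) = n.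
Proof. by elim: n => //= n ->. Qed.

Lemma prefix_eqP n (x y : nat -> bool) :
  prefix n x = prefix n y <-> forall i, (i < n)%N -> x i = y i.
Proof.
elim: n => [|n IH] /=; first by split.
split=> [[xy /IH h] i|h]; first by rewrite ltnS leq_eqVlt => /predU1P[->//|/h].
by rewrite h// (IH.2 _)// => i ilt; apply: h; rewrite ltnS ltnW.
Qed.

(** Measurability for the product sigma-algebra on binary sequences, stated on
    the coordinates that generate it. *)
Definition measurable_digits d (Om : measurableType d) (z : Om -> nat -> bool) :=
  forall n, measurable [set w | z w n].

Lemma measurable_prefix d (Om : measurableType d) (z : Om -> nat -> bool) n s :
  measurable_digits z -> measurable [set w | prefix n (z w) = s].
Proof.
move=> mz; elim: n s => [|n IH] [|b s] /=.
- by rewrite (_ : [set _ | _] = setT)//; apply/seteqP; split.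
- by rewrite (_ : [set _ | _] = set0)//; apply/seteqP; split.
- by rewrite (_ : [set _ | _] = set0)//; apply/seteqP; split.
rewrite (_ : [set _ | _] =
  (if b then [set w | z w n] else ~` [set w | z w n]) `&` [set w | prefix n (z w) = s]).
  by apply: measurableI => //; case: b; [exact: mz|exact/measurableC/mz].
apply/seteqP; split=> w /=.
  by move=> [<- <-]; split => //; case: ifP => //= /negP.
by case: b => -[/= zn ->]; [rewrite zn|move/negP/negbTE: zn => ->].
Qed.

Lemma measurable_fibers d (Om : measurableType d) (T : countType) (f : Om -> T) :
  (forall t, measurable [set w | f w = t]) ->
  forall Q : set T, measurable [set w | Q (f w)].
Proof.
move=> mf Q; rewrite (_ : [set _ | _] = \bigcup_(t in Q) [set w | f w = t]).
  rewrite bigcup_set_type; apply: countable_bigcupT_measurable => //.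
  by rewrite (eq_countable (card_setT _)).
by apply/seteqP; split=> w; [move=> h; exists (f w)|move=> [t Qt wt]; rewrite /= wt].
Qed.

(** The cylinders of a sequence form a filter that converges to it for the
    topology of pointwise convergence. *)
Lemma nbhs_cantor (x : cantor_space) (A : set cantor_space) : nbhs x A ->
  exists n, forall y : cantor_space, prefix n x = prefix n y -> A y.
Proof.
pose F := filter_from [set: nat] (fun n => [set y : cantor_space | prefix n x = prefix n y]).
have FF : Filter F.
  apply: filter_from_filter; first by exists 0%N.
  move=> m n _ _; exists (maxn m n) => // y /prefix_eqP h /=.
  by split; apply/prefix_eqP => i ilt; apply: h; rewrite leq_max ilt ?orbT.
have Fx : F --> x.
  apply/cvg_sup => N U [V] [[W] oW <-] WfN WU.
  exists N.+1 => // y /= [xy _]; apply: WU => /=.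
  by move: WfN; rewrite /= /proj xy.
by move=> /Fx[n _ h]; exists n => y; exact: h.
Qed.

Lemma closed_cylinder n (x : cantor_space) :
  closed [set y : cantor_space | prefix n y = prefix n x].
Proof.
elim: n => [|n IH].
  rewrite (_ : [set _ | _] = setT); first exact: closedT.
  by apply/seteqP; split.
rewrite (_ : [set _ | _] = (proj n) @^-1` [set x n] `&`
    [set y : cantor_space | prefix n y = prefix n x]).
  apply: closedI => //; apply: (@closed_comp cantor_space bool).
    by move=> y _; exact: proj_continuous.
  exact: discrete_closed.
apply/seteqP; split=> y /=; first by case.
by rewrite /proj => -[-> ->].
Qed.

(** The code of x follows the leftmost branch of the tree of cylinders whose
    image contains x. It depends on x in a Borel way because the images of the
    cylinders are compact. *)
Lemma borel_cantor_section (R : realType) (X : pmetricType R) :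
  compact [set: X] -> exists2 c : cantor_space -> X, continuous c &
    exists2 s : borel X -> cantor_space, measurable_digits s &
      forall x, c (s x) = x.
Proof.
move=> cX; have [c cc] := @cantor_surj R X cX (@metric_hausdorff R X).
exists c => //.
pose cyl (s : seq bool) := c @` [set y : cantor_space | prefix (size s) y = s].
have cyl_closed s : closed (cyl s).
  apply: compact_closed; first exact: metric_hausdorff.
  apply: continuous_compact; first exact: continuous_subspaceT.
  apply: (subclosed_compact _ cantor_space_compact) => //.
  have [->|/set0P[x <-]] := eqVneq [set y : cantor_space | prefix (size s) y = s] set0.
    exact: closed0.
  by rewrite size_prefix; exact: closed_cylinder.
pose step x s := ~~ `[<cyl (false :: s) x>] :: s.
pose branch x n := iter n (step x) [::].
have size_branch x n : size (branch x n) = n by elim: n => //= n ->.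
have branch_in x n : cyl (branch x n) x.
  elim: n => [|n [y yb yx]].
    by have /'surj_c [y _ yx] : [set: X] x by []; exists y.
  rewrite /= size_branch in yb; rewrite /= /step -/(branch x n).
  case: asboolP => [//|nx]; exists y => //=; rewrite size_branch yb.
  congr (_ :: _); apply: contrapT => /negP yn; apply: nx; exists y => //=.
  by rewrite size_branch yb (negbTE yn).
pose s x n := head false (branch x n.+1).
have prefix_s x n : prefix n (s x) = branch x n.
  by elim: n => //= n ->.
have mbranch n t : measurable [set x : borel X | branch x n = t].
  elim: n t => [|n IH] t.
    have [->|tn] := eqVneq t [::].
      by rewrite (_ : [set _ | _] = setT)//; apply/seteqP; split.
    by rewrite (_ : [set _ | _] = set0)//; apply/seteqP; split => //= x /esym/eqP; rewrite (negbTE tn).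
  case: t => [|b t].
    by rewrite (_ : [set _ | _] = set0)//; apply/seteqP; split.
  have mC : measurable (cyl (false :: t) : set (borel X)) by exact: closed_borel.
  rewrite (_ : [set _ | _] = (if b then ~` cyl (false :: t) else cyl (false :: t))
      `&` [set x : borel X | branch x n = t]); last first.
    apply/seteqP; split => x /=; rewrite /step -/(branch x n).
      by move=> [<- ->]; case: asboolP.
    by case: b => -[/= h ->]; congr (_ :: _); apply/negP; rewrite ?asboolE//; apply/asboolP.
  by apply: measurableI => //; case: b => //; exact: measurableC.
exists s.
  by move=> n; exact: (measurable_fibers (mbranch n.+1) [set t | head false t]).
move=> x; apply: (@metric_hausdorff R X) => U V nU nV.
have /nbhs_cantor[n hn] : nbhs (s x : cantor_space) (c @^-1` U) by exact: cc.
have [y /= yb yx] := branch_in x n; exists x; split; last exact: nbhs_singleton.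
by rewrite -yx; apply: hn; rewrite prefix_s -yb size_branch.
Qed.

(** * Conditional densities *)

Section density.
Context d (T : measurableType d) (R : realType) (P : probability T R).
Local Open Scope ereal_scope.

(** As nu is below the measure of density k, truncating a Radon-Nikodym
    derivative of nu at k changes none of its integrals. *)
Lemma density_below (nu : {measure set T -> \bar R}) (k : T -> R) :
  measurable_fun setT k -> (forall x, 0 <= k x)%R ->
  nu setT < +oo ->
  (forall B, measurable B -> nu B <= \int[P]_(x in B) (k x)%:E) ->
  exists h : T -> R, [/\ measurable_fun setT h, forall x, (0 <= h x <= k x)%R &
    forall B, measurable B -> \int[P]_(x in B) (h x)%:E = nu B].
Proof.
move=> mk k0 nuoo nuk.
pose nu0 : {finite_measure set T -> \bar R} := mfrestr measurableT nuoo.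
have nu0E B : nu0 B = nu B by rewrite /nu0 /= /mfrestr /mrestr setIT.
have nuP : nu0 `<< P.
  apply/null_content_dominatesP => B mB B0; rewrite nu0E; apply/eqP.
  rewrite eq_le measure_ge0 andbT (le_trans (nuk _ mB))//.
  rewrite null_set_integral//.
  by apply/measurable_EFinP; exact: measurable_funTS.
have [e [e0 efin ie eE]] := radon_nikodym_sigma_finite nuP.
have me : measurable_fun setT e by exact: measurable_int ie.
pose f x := fine (e x).
have fE x : e x = (f x)%:E by rewrite fineK.
have f0 x : (0 <= f x)%R by rewrite -lee_fin -fE.
have mf : measurable_fun setT f.
  by apply/measurable_EFinP; rewrite (_ : _ \o _ = e)//; apply/funext => x /=; rewrite fE.
have nuf B : measurable B -> \int[P]_(x in B) (f x)%:E = nu B.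
  by move=> mB; rewrite -nu0E eE//; apply: eq_integral => x _; rewrite fE.
exists (f \min k)%R; split.
- exact: measurable_minr.
- by move=> x; rewrite /= le_min f0 k0 ge_min lexx orbT.
move=> B mB.
pose N := [set x | k x < f x]%R.
have mN : measurable N by rewrite -[N]setTI; exact: measurable_fun_ltr.
have m0 x : 0 <= (Num.min (f x) (k x))%:E by rewrite lee_fin le_min f0 k0.
have mm : measurable_fun setT (fun x => (Num.min (f x) (k x))%:E).
  by apply/measurable_EFinP; exact: measurable_minr.
apply/eqP; rewrite eq_le; apply/andP; split.
  rewrite -nuf//; apply: ge0_le_integral => //.
  - by move=> x _; exact: m0.
  - exact: measurable_funTS.
  - by apply/measurable_EFinP; exact: measurable_funTS.
  - by move=> x _; rewrite lee_fin /= ge_min lexx.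
rewrite -[in leRHS](setUIDK B N) ge0_integral_setU//; last 5 first.
- exact: measurableI.
- exact: measurableD.
- exact: measurable_funTS.
- by move=> x _; exact: m0.
- by apply/disj_set2P; rewrite setDE setIACA setICr setI0.
rewrite (eq_integral (fun x => (k x)%:E)); last first.
  by move=> x; rewrite inE => -[_ Nx] /=; rewrite min_r// ltW.
rewrite [X in _ + X](eq_integral (fun x => (f x)%:E)); last first.
  by move=> x; rewrite inE => -[_ /negP]; rewrite -leNgt => fk /=; rewrite min_l.
rewrite nuf; last exact: measurableD.
rewrite (le_trans _ (leeD (nuk _ (measurableI _ _ mB mN)) (lexx _)))//.
rewrite -measureU ?setUIDK//; [exact: measurableI|exact: measurableD|].
by rewrite setDE setIACA setICr setI0.
Qed.

End density.

(** * Resampling a binary sequence *)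

Section unif01.
Variable R : realType.

Definition unif01 : set (measurableTypeR R) -> \bar R :=
  mrestr lebesgue_measure (measurable_itv `[0%R, 1%R[).

HB.instance Definition _ := Measure.on unif01.

Let unif01_setT : unif01 setT = 1%E.
Proof.
by rewrite /unif01 /mrestr setTI lebesgue_measure_itv /= lte_fin ltr01 oppr0 adde0.
Qed.

HB.instance Definition _ := Measure_isProbability.Build _ _ _ unif01 unif01_setT.

(** Only the part of A inside the unit interval counts, so its description is
    required there only. *)
Lemma unif01_itv (a l : R) (A : set R) : 0 <= a -> 0 <= l -> a + l <= 1 ->
  (forall u, 0 <= u < 1 -> A u <-> a <= u < a + l) -> unif01 A = l%:E.
Proof.
move=> a0 l0 al1 Aal; rewrite /unif01 /mrestr.
rewrite (_ : A `&` _ = `[a, a + l[%classic).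
  rewrite lebesgue_measure_itv /= lte_fin ltrDl.
  by rewrite -EFinD addrAC subrr add0r; case: ltgtP l0 => // <-.
apply/seteqP; split=> u; rewrite /= !in_itv /=.
  by move=> [Au u01]; apply/Aal.
move=> /[dup] aul /andP[au ual].
have u01 : 0 <= u < 1 by rewrite (le_trans a0 au) (lt_le_trans ual).
by split=> //; apply/Aal.
Qed.

End unif01.

Section random_code.
Context (R : realType) d0 (Om0 : measurableType d0) (P0 : probability Om0 R)
  d (Y : measurableType d) (muY : probability Y R)
  (z : Om0 -> nat -> bool) (b : Om0 -> Y).
Hypotheses (mz : measurable_digits z) (mb : measurable_fun setT b)
  (b_law : forall B, measurable B -> P0 (b @^-1` B) = muY B).
Local Open Scope ereal_scope.

Let cyl t := [set w | prefix (size t) (z w) = t].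
Let nu t (B : set Y) : \bar R := P0 (cyl t `&` b @^-1` B).

Let mcyl t : measurable (cyl t).
Proof. exact: measurable_prefix. Qed.

Let mpre B : measurable B -> measurable (b @^-1` B).
Proof. by move=> mB; rewrite -[X in measurable X]setTI; exact: mb. Qed.

Let nu_split t B : measurable B -> nu t B = nu (false :: t) B + nu (true :: t) B.
Proof.
move=> mB; rewrite /nu -measureU.
- congr (P0 _); apply/seteqP; split=> w; last by move=> [[[_ wt] wB]|[[_ wt] wB]].
  move=> [wt wB]; have cylE c : z w (size t) = c -> cyl (c :: t) w.
    by move=> zw; rewrite /cyl /= zw wt.
  by case zw : (z w (size t)); [right|left]; split => //; exact: cylE.
- by apply: measurableI; [exact: mcyl|exact: mpre].
- by apply: measurableI; [exact: mcyl|exact: mpre].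
- by apply/seteqP; split=> // w [[+ _] [+ _]]; rewrite /cyl /= => -[-> _] [].
Qed.

Let nu_measure t : exists m : {measure set Y -> \bar R}, forall B, m B = nu t B.
Proof.
pose m : {measure set Om0 -> \bar R} := mrestr P0 (mcyl t).
pose mg : {measure set Y -> \bar R} := pushforward m b.
exists (mg mb).
by move=> B; rewrite /nu setIC.
Qed.

(** k is the conditional probability, given b, that the digits of z start with
    the word t. *)
Definition is_density t (k : Y -> R) := [/\ measurable_fun setT k,
  forall y, (0 <= k y)%R &
  forall B, measurable B -> \int[muY]_(y in B) (k y)%:E = nu t B].

Let nu_fin t B : measurable B -> nu t B \is a fin_num.
Proof.
move=> mB; rewrite /nu fin_num_measure//.
by apply: measurableI; [exact: mcyl|exact: mpre].
Qed.

(** Splitting a density exactly, rather than choosing the densities of all words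
    separately, makes the additivity over one-digit extensions hold everywhere
    and not merely almost everywhere. *)
Lemma is_density_split t k : exists h, is_density t k ->
  [/\ is_density (false :: t) h, is_density (true :: t) (k \- h)%R &
      forall y, (h y <= k y)%R].
Proof.
have [[mk k0 kE]|] := pselect (is_density t k); last by exists k.
have [m mE] := nu_measure (false :: t).
have moo : m setT < +oo by rewrite mE ltey_eq nu_fin.
have mk' B : measurable B -> m B <= \int[muY]_(y in B) (k y)%:E.
  by move=> mB; rewrite mE kE//= [leRHS]nu_split// leeDl.
have [h [mh hk hE]] := density_below mk k0 moo mk'.
exists h => _; have h0 y : (0 <= h y)%R by have /andP[] := hk y.
have hk' y : (h y <= k y)%R by have /andP[] := hk y.
split=> //; first by split=> // B mB; rewrite hE.
split; [exact: measurable_funB|by move=> y; rewrite /= subr_ge0|].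
move=> B mB; have := kE B mB; rewrite nu_split// -mE -hE//.
have -> : \int[muY]_(y in B) (k y)%:E =
    \int[muY]_(y in B) ((h y)%:E + ((k \- h)%R y)%:E).
  by apply: eq_integral => y _; rewrite -EFinD /= subrKC.
rewrite ge0_integralD//.
- move=> /(congr1 (fun e => e - \int[muY]_(y in B) (h y)%:E)).
  by rewrite [X in X - _ = _]addeC [X in _ = X - _]addeC !addeK// hE// mE nu_fin.
- by move=> y _; rewrite lee_fin.
- by apply/measurable_EFinP; exact: measurable_funTS.
- by move=> y _; rewrite lee_fin /= subr_ge0.
- by apply/measurable_EFinP/measurable_funTS; exact: measurable_funB.
Qed.

(** Given b = y, the digits are drawn from a point u of the unit interval: the
    word t owns the subinterval of length dens t y starting at left t y, which
    its two one-digit extensions share, so that the digits read from a uniform u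
    start with t with probability dens t y. *)
Lemma random_code : exists x : Y * R -> nat -> bool,
  measurable_digits (x : Y * measurableTypeR R -> nat -> bool) /\
  forall d1 (Om1 : measurableType d1) (P1 : probability Om1 R) (b1 : Om1 -> Y),
    measurable_fun setT b1 ->
    (forall B, measurable B -> P1 (b1 @^-1` B) = muY B) ->
    forall t B, measurable B ->
    (P1 \x @unif01 R) [set u | prefix (size t) (x (b1 u.1, u.2)) = t /\ B (b1 u.1)] =
    P0 [set w | prefix (size t) (z w) = t /\ B (b w)].
Proof.
have [split splitP] := choice (fun tk => is_density_split tk.1 tk.2).
pose dens := fix dens (t : seq bool) : Y -> R :=
  if t is c :: t' then
    if c then (dens t' \- split (t', dens t'))%R else split (t', dens t')
  else cst 1%R.
pose left := fix left (t : seq bool) (y : Y) : R :=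
  (if t is c :: t' then left t' y + (if c then dens (false :: t') y else 0) else 0)%R.
have densP t : is_density t (dens t).
  elim: t => [|c t IH]; last by have [] := splitP (t, dens t) IH; case: c.
  split=> // B mB.
  transitivity (muY B); first by rewrite -[RHS]mul1e -integral_cst.
  rewrite -b_law//; congr (P0 _).
  by apply/seteqP; split=> [w Bw|w []//]; split.
have mdens t : measurable_fun setT (dens t) by have [] := densP t.
have dens0 t y : (0 <= dens t y)%R by have [_ + _] := densP t; apply.
have densD t y : (dens (false :: t) y + dens (true :: t) y = dens t y)%R.
  by rewrite /= subrKC.
have mleft t : measurable_fun setT (left t).
  elim: t => [|c t IH]; first exact: measurable_cst.
  case: c; last by apply: measurable_funD => //; exact: measurable_cst.
  by apply: measurable_funD => //; exact: (mdens (false :: t)).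
have left0 t y : (0 <= left t y)%R.
  by elim: t => //= c t IH; rewrite addr_ge0//; case: c => //; exact: (dens0 (false :: t)).
have left1 t y : (left t y + dens t y <= 1)%R.
  elim: t => [|c t IH] /=; first by rewrite add0r.
  case: c; first by rewrite -addrA subrKC.
  rewrite addr0 (le_trans _ IH)// lerD2l -(densD t y) lerDl.
  exact: (dens0 (true :: t)).
pose state := fix state (n : nat) (yu : Y * R) : seq bool :=
  if n is m.+1 then
    (left (state m yu) yu.1 + dens (false :: state m yu) yu.1 <= yu.2)%R :: state m yu
  else [::].
pose x yu n := head false (state n.+1 yu).
have prefix_x yu n : prefix n (x yu) = state n yu by elim: n => //= n ->.
have stateP y u t : (0 <= u < 1)%R ->
    state (size t) (y, u) = t <-> (left t y <= u < left t y + dens t y)%R.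
  move=> u01; elim: t => [|c t IH] /=; first by rewrite add0r u01.
  split.
    move=> [+ st]; rewrite st; have /IH/andP[lu ul] := st.
    case: c => [-> /=|/negbT]; first by rewrite -addrA subrKC.
    by rewrite -ltNge addr0 lu => ->.
  move=> h; have tu : (left t y <= u < left t y + dens t y)%R.
    move: h; case: c => /andP[h1 h2].
      rewrite -addrA subrKC in h2; rewrite h2 andbT (le_trans _ h1)// lerDl.
      exact: (dens0 (false :: t)).
    rewrite addr0 in h1 h2; rewrite h1 (lt_le_trans h2)// lerD2l -(densD t y) lerDl.
    exact: (dens0 (true :: t)).
  have st := IH.2 tu; rewrite st; congr (_ :: _).
  move: h; case: c => /andP[h1 h2]; first by rewrite h1.
  by rewrite addr0 in h2; apply/negbTE; rewrite -ltNge.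
have mstate n t : measurable [set yu : Y * measurableTypeR R | state n yu = t].
  elim: n t => [|n IH] [|c t] /=.
  - by rewrite (_ : [set _ | _] = setT)//; apply/seteqP; split.
  - by rewrite (_ : [set _ | _] = set0)//; apply/seteqP; split.
  - by rewrite (_ : [set _ | _] = set0)//; apply/seteqP; split.
  pose S := [set yu : Y * measurableTypeR R |
    left t yu.1 + dens (false :: t) yu.1 <= yu.2]%R.
  have mS : measurable S.
    rewrite -[S]setTI; apply: measurable_fun_ler => //.
    by apply: measurable_funD; apply: measurableT_comp => //; exact: (mdens (false :: t)).
  rewrite (_ : [set _ | _] = (if c then S else ~` S) `&` [set yu | state n yu = t]).
    by apply: measurableI => //; case: c => //; exact: measurableC.
  apply/seteqP; split=> yu; rewrite /S /=.
    by move=> [<- <-]; case: ifP => //= /negP.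
  by case: c => -[/= h ->]; congr (_ :: _) => //; apply/negbTE/negP.
exists x; split.
  by move=> n; exact: (measurable_fibers (mstate n.+1) [set t | head false t]).
move=> d1 Om1 P1 b1 mb1 b1_law t B mB.
have fin_law : \int[P1]_(w in b1 @^-1` B) (dens t (b1 w))%:E = nu t B.
  have [_ _ <- //] := densP t.
  transitivity (\int[pushforward P1 b1]_(y in B) (dens t y)%:E); last first.
    by apply: eq_measure_integral => A mA _; exact: b1_law.
  rewrite (ge0_integral_pushforward mb1)//.
  - by apply/measurable_EFinP; exact: measurable_funTS.
  - by move=> y _; rewrite lee_fin.
transitivity (nu t B); last by [].
rewrite -fin_law /product_measure1 [RHS]integral_mkcond.
apply: eq_integral => w _; rewrite patchE.
case: ifPn => [|nB].
  rewrite inE => Bw; apply: (@unif01_itv _ (left t (b1 w))) => // u u01.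
  rewrite -(stateP (b1 w) u t u01) /xsection /=; split.
    by rewrite inE /= => -[st _]; rewrite -prefix_x.
  by move=> st; rewrite inE; split => //=; rewrite prefix_x.
rewrite /= [X in unif01 X](_ : _ = set0) ?measure0//.
apply/seteqP; split=> // u; rewrite /xsection /= inE => -[_ Bw].
by move/negP: nB; apply; rewrite inE.
Qed.

End random_code.

(** * Resampling a point of a compact metric space *)

(** A countable set of values is handled by summing over the fibers. *)
Lemma eq_measure_fibers (R : realType) d1 (Om1 : measurableType d1)
    d2 (Om2 : measurableType d2)
    (m1 : {measure set Om1 -> \bar R}) (m2 : {measure set Om2 -> \bar R})
    (T : countType) (f1 : Om1 -> T) (f2 : Om2 -> T) (A1 : set Om1) (A2 : set Om2) :
  measurable A1 -> measurable A2 ->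
  (forall t, measurable [set w | f1 w = t]) ->
  (forall t, measurable [set w | f2 w = t]) ->
  (forall t, m1 [set w | f1 w = t /\ A1 w] = m2 [set w | f2 w = t /\ A2 w]) ->
  forall Q : set T, m1 [set w | Q (f1 w) /\ A1 w] = m2 [set w | Q (f2 w) /\ A2 w].
Proof.
move=> mA1 mA2 mf1 mf2 m12 Q.
have sumE d (Om : measurableType d) (m : {measure set Om -> \bar R})
    (f : Om -> T) (A : set Om) : measurable A ->
    (forall t, measurable [set w | f w = t]) ->
    m [set w | Q (f w) /\ A w] =
    (\sum_(k <oo) m [set w | (Q (f w) /\ pickle (f w) = k) /\ A w])%E.
  move=> mA mf; rewrite (_ : [set w | _] =
      \bigcup_k [set w | (Q (f w) /\ pickle (f w) = k) /\ A w]); last first.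
    apply/seteqP; split=> w; first by move=> [Qw Aw]; exists (pickle (f w)).
    by move=> [k _ [[]]].
  rewrite measure_bigcup//.
  - by apply: eq_eseriesl => k; rewrite in_setT.
  - move=> k _; apply: measurableI => //.
    exact: (measurable_fibers mf [set t | Q t /\ pickle t = k]).
  - by move=> i j _ _ [w [[[_ <-] _] [[_ ->] _]]].
rewrite !sumE//; apply: eq_eseriesr => k _.
have [[t [Qt tk]]|nt] := pselect (exists t, Q t /\ pickle t = k).
  have fiberE d (Om : measurableType d) (f : Om -> T) (A : set Om) :
      [set w | (Q (f w) /\ pickle (f w) = k) /\ A w] = [set w | f w = t /\ A w].
    apply/seteqP; split=> w /=; last by move=> [-> Aw].
    by move=> [[_ fk] Aw]; split => //; apply: (pcan_inj pickleK); rewrite fk tk.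
  by rewrite !fiberE m12.
have emptyE d (Om : measurableType d) (f : Om -> T) (A : set Om) :
    [set w | (Q (f w) /\ pickle (f w) = k) /\ A w] = set0.
  by apply/seteqP; split=> // w /= [fk _]; apply: nt; exists (f w).
by rewrite !emptyE !measure0.
Qed.

Section randomization.
Context (R : realType) (X : pmetricType R) d0 (Om0 : measurableType d0)
  (P0 : probability Om0 R) d (Y : measurableType d) (muY : probability Y R)
  (a : Om0 -> X) (b : Om0 -> Y).
Hypotheses (cX : compact [set: X])
  (ma : @measurable_fun _ _ Om0 (borel X) setT a) (mb : measurable_fun setT b)
  (b_law : forall B, measurable B -> P0 (b @^-1` B) = muY B).

(** Resample the binary code z of a, then decode. The event that the decoded
    point lies in an open set O is the increasing union over n of the events
    that the first n digits already force this, and the latter have the same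
    probability for the code z and for its resampled version x. *)
Lemma randomization : exists F : Y * R -> X,
  @measurable_fun _ _ (Y * measurableTypeR R)%type (borel X) setT F /\
  forall d1 (Om1 : measurableType d1) (P1 : probability Om1 R) (b1 : Om1 -> Y),
    measurable_fun setT b1 ->
    (forall B, measurable B -> P1 (b1 @^-1` B) = muY B) ->
    forall (O : set X) B, open O -> measurable B ->
    (P1 \x @unif01 R)%E [set u | O (F (b1 u.1, u.2)) /\ B (b1 u.1)] =
    P0 [set w | O (a w) /\ B (b w)].
Proof.
have [c cc [s ms cs]] := borel_cantor_section cX.
pose z w : nat -> bool := s (a w).
have mz : measurable_digits z.
  by move=> n; rewrite -[X in measurable X]setTI; apply: (ma measurableT (ms n)).
have [x [mx x_law]] := random_code mz mb b_law.
pose W (O : set X) n :=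
  [set t | forall v : cantor_space, prefix n v = t -> O (c v)].
have WE O (v : cantor_space) : open O -> O (c v) <-> exists n, W O n (prefix n v).
  move=> oO; split=> [Ov|[n]]; last by apply.
  have /nbhs_cantor[n hn] : nbhs v (c @^-1` O) by apply: cc; exact: open_nbhs_nbhs.
  by exists n => v' vv'; apply: hn; rewrite vv'.
have Wmono O m n (v : nat -> bool) : (m <= n)%N ->
    W O m (prefix m v) -> W O n (prefix n v).
  move=> mn h v' /prefix_eqP vv'; apply: h; apply/prefix_eqP => i im.
  by apply: vv'; exact: leq_trans mn.
exists (fun yu => c (x yu)); split.
  apply: borel_funP => O oO.
  rewrite (_ : _ @^-1` _ = \bigcup_n [set yu | W O n (prefix n (x yu))]).
    apply: bigcupT_measurable => n.
    by apply: (measurable_fibers (f := fun yu => prefix n (x yu))) => t; exact: measurable_prefix.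
  apply/seteqP; split=> yu; first by move=> /= /(WE _ _ oO)[n]; exists n.
  by move=> [n _ h]; apply/(WE _ _ oO); exists n.
move=> d1 Om1 P1 b1 mb1 b1_law O B oO mB.
pose x1 (u : Om1 * measurableTypeR R) := x (b1 u.1, u.2).
have mx1 : measurable_digits x1.
  move=> n; have mxn := mx n.
  rewrite (_ : [set _ | _] = (fun u => (b1 u.1, u.2)) @^-1`
    [set yu : Y * measurableTypeR R | x yu n])//.
  rewrite -[X in measurable X]setTI; apply: measurable_fun_pair => //.
  exact: (measurableT_comp mb1).
have mB1 : measurable [set u : Om1 * measurableTypeR R | B (b1 u.1)].
  by rewrite -[X in measurable X]setTI; apply: (measurableT_comp mb1).
have mB0 : measurable [set w | B (b w)].
  by rewrite -[X in measurable X]setTI; apply: mb.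
have limE d' (Om : measurableType d') (m : {measure set Om -> \bar R})
    (v : Om -> nat -> bool) (A : set Om) : measurable_digits v -> measurable A ->
    m [set u | W O n (prefix n (v u)) /\ A u] @[n --> \oo] -->
    m [set u | O (c (v u)) /\ A u].
  move=> mv mA.
  rewrite (_ : [set u | O _ /\ _] =
    \bigcup_n [set u | W O n (prefix n (v u)) /\ A u]); last first.
    apply/seteqP; split=> u.
      by move=> [/(WE _ _ oO)[n h] Au]; exists n.
    by move=> [n _ [h Au]]; split => //; apply/(WE _ _ oO); exists n.
  have mW n : measurable [set u | W O n (prefix n (v u)) /\ A u].
    apply: measurableI => //.
    by apply: (measurable_fibers (f := fun u => prefix n (v u))) => t; exact: measurable_prefix.
  apply: nondecreasing_cvg_mu => //; first exact: bigcupT_measurable.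
  move=> m' n' mn; apply/subsetPset => u [h Au]; split => //; exact: Wmono h.
have lim1 := limE _ _ (P1 \x @unif01 R)%E x1 _ mx1 mB1.
have lim0 := limE _ _ P0 z _ mz mB0.
have E n : (P1 \x @unif01 R)%E [set u | W O n (prefix n (x1 u)) /\ B (b1 u.1)] =
    P0 [set w | W O n (prefix n (z w)) /\ B (b w)].
  apply: (eq_measure_fibers (f1 := fun u => prefix n (x1 u))
     (f2 := fun w => prefix n (z w)) mB1 mB0) => t; try exact: measurable_prefix.
  have [<-|tn] := eqVneq (size t) n; first exact: x_law.
  rewrite (_ : [set u | _] = set0); last first.
    apply/seteqP; split=> // u [/= ut _]; move: tn; rewrite -ut size_prefix.
    by rewrite eqxx.
  rewrite [X in _ = P0 X](_ : _ = set0) ?measure0//.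
  apply/seteqP; split=> // u [/= ut _]; move: tn; rewrite -ut size_prefix.
  by rewrite eqxx.
rewrite (_ : [set w | O (a w) /\ _] = [set w | O (c (z w)) /\ B (b w)]); last first.
  by apply/seteqP; split=> w; rewrite /z /= cs.
rewrite (eq_cvg _ _ E) in lim1.
exact: (cvg_unique _ lim1 lim0).
Qed.

End randomization.

(** * Gluing of couplings *)

(** Open rectangles are stable under intersection and, thanks to countable
    bases, generate the Borel sets of the product. *)
Lemma eq_measure_open_rect (R : realType) (S T : ptopologicalType)
    (m1 m2 : {measure set (borel (S * T)%type) -> \bar R}) :
  @second_countable S -> @second_countable T -> (m1 setT < +oo)%E ->
  (forall (U : set S) (V : set T), open U -> open V ->
     m1 (U `*` V) = m2 (U `*` V)) ->
  forall A, measurable A -> m1 A = m2 A.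
Proof.
move=> [A cA Ab] [B cB Bb] m1oo m12 E mE.
pose G := [set U `*` V | U in @open S & V in @open T].
have Gopen (W : set (S * T)) : G W -> open W.
  move=> [U oU [V oV <-]]; rewrite openE => -[x y] [/= Ux Vy].
  by exists (U, V) => //; split; apply: open_nbhs_nbhs.
apply: (@measure_unique _ R (borel (S * T)%type) G (fun=> setT)) => //.
- apply/seteqP; split.
    apply: smallest_sub; first exact: smallest_sigma_algebra.
    move=> O oO; rewrite (open_basis_bigcup (second_countable_prod Ab Bb) oO).
    set D := [set U | _]; have [|F DF ->] := @countable_bigcup_seq _ D.
      apply: (sub_countable _ (countableX cA cB)).
      apply: card_le_trans (card_image_le (fun U => U.1 `*` U.2) _).
      by apply: subset_card_le => U [].
    apply: sigma_algebra_bigcup => n; have [[[[U V] [/= AU BV] <-] _]|->] := DF n.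
      by apply: sub_sigma_algebra; exists U; [exact: Ab.1|exists V => //; exact: Bb.1].
    exact: sigma_algebra0.
  apply: sub_sigma_algebra2 => W; exact: Gopen.
- move=> _ _ [U oU [V oV <-]] [U' oU' [V' oV' <-]].
  exists (U `&` U'); first exact: openI.
  by exists (V `&` V'); [exact: openI|rewrite setXI].
- by move=> _; exists setT; [exact: openT|exists setT; [exact: openT|rewrite setXTT]].
- by apply/seteqP; split=> // u _; exists 0%N.
- by move=> _ [U oU [V oV <-]]; exact: m12.
Qed.

(** Draw (y, z) from the second coupling, then draw x from the first coupling
    conditionally on y, with the help of an independent uniform variable. *)
Lemma gluing (R : realType) (X Y Z : mmspace R)
    (g1 : probability (borel (X * Y)%type) R)
    (g2 : probability (borel (Y * Z)%type) R) :
  coupling X Y g1 -> coupling Y Z g2 ->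
  exists d (Om : measurableType d) (P : probability Om R)
      (f : Om -> X) (g : Om -> Y) (h : Om -> Z)
      (mf : @measurable_fun _ _ Om (borel X) setT f)
      (mg : @measurable_fun _ _ Om (borel Y) setT g)
      (mh : @measurable_fun _ _ Om (borel Z) setT h),
    (forall A, measurable A -> joint_law P mf mg A = g1 A) /\
    (forall A, measurable A -> joint_law P mg mh A = g2 A).
Proof.
move=> [g1X g1Y] [g2Y g2Z].
have mfst := @measurable_borel_fst R X Y; have msnd := @measurable_borel_snd R X Y.
have mfst' := @measurable_borel_fst R Y Z; have msnd' := @measurable_borel_snd R Y Z.
have [F [mF F_law]] := randomization (@mmcompact R X) mfst msnd g1Y.
pose P : probability (borel (Y * Z)%type * measurableTypeR R)%type R :=
  (g2 \x @unif01 R)%E.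
pose f (u : borel (Y * Z)%type * measurableTypeR R) : X := F (u.1.1, u.2).
pose g (u : borel (Y * Z)%type * measurableTypeR R) : Y := u.1.1.
pose h (u : borel (Y * Z)%type * measurableTypeR R) : Z := u.1.2.
have mg : @measurable_fun _ _ _ (borel Y) setT g.
  exact: (measurableT_comp mfst').
have mh : @measurable_fun _ _ _ (borel Z) setT h.
  exact: (measurableT_comp msnd').
have mf : @measurable_fun _ _ _ (borel X) setT f.
  by apply: (measurableT_comp mF); apply: measurable_fun_pair.
exists _, _, P, f, g, h, mf, mg, mh; split=> A mA; last first.
  rewrite joint_lawE (_ : _ @^-1` A = A `*` setT).
    rewrite /P /= product_measure1E// -[RHS]mule1; congr (_ * _)%E.
    exact: probability_setT.
  by apply/seteqP; split=> [[[y z] u]|[[y z] u] []].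
move: A mA; apply: eq_measure_open_rect.
- exact/compact_second_countable/mmcompact.
- exact/compact_second_countable/mmcompact.
- rewrite [X in (X < _)%E](_ : _ = 1%E) ?ltry//; exact: probability_setT.
move=> U V oU oV.
exact: (F_law _ _ g2 (fst : borel (Y * Z)%type -> Y) mfst' g2Y U V oU (open_borel oV)).
Qed.

(** * Pseudometric axioms and monotonicity of the Gromov-Wasserstein distances *)

Section dis.
Context {R : realType}.
Implicit Types (X Y Z : mmspace R) (p q : \bar R).
Local Open Scope ereal_scope.

Lemma eq_dis p q X Y (g1 g2 : probability (borel (X * Y)%type) R) :
  (forall A, measurable A -> g1 A = g2 A) -> dis p q g1 = dis p q g2.
Proof.
move=> g12; case: p => [r||] //.
  rewrite /dis; congr (_ `^ _).
  rewrite (eq_measure_integral g2) => [|A mA _]; last exact: g12.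
  apply: eq_integral => z' _.
  by apply: eq_measure_integral => A mA _; exact: g12.
suff gsupp : supp g1 = supp g2 by rewrite /dis gsupp.
apply/seteqP; split=> z h U oU Uz; have := h U oU Uz;
  by rewrite g12//; exact: (@open_borel (X * Y)%type).
Qed.

Lemma coupling_joint_law d (Om : measurableType d) X Y (P : probability Om R)
    (f : Om -> X) (g : Om -> Y)
    (mf : @measurable_fun _ _ Om (borel X) setT f)
    (mg : @measurable_fun _ _ Om (borel Y) setT g) :
  (forall A : set (borel X), measurable A -> P (f @^-1` A) = mmmeasure X A) ->
  (forall B : set (borel Y), measurable B -> P (g @^-1` B) = mmmeasure Y B) ->
  coupling X Y (joint_law P mf mg).
Proof. by move=> Pf Pg; split=> A mA; [exact: Pf|exact: Pg]. Qed.

Lemma dis_coupling p q X Y (g : probability (borel (X * Y)%type) R) :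
  1 <= p -> 1 <= q -> dis p q g =
    'N[(g \x g)%E]_p[EFin \o distortion (fst : borel (X * Y)%type -> X)
                                        (snd : borel (X * Y)%type -> Y) q].
Proof.
move=> p1 q1.
rewrite -(dis_joint_law g (@measurable_borel_fst R X Y) (@measurable_borel_snd R X Y))//.
apply: eq_dis => A mA; rewrite joint_lawE; congr (g _).
by apply/seteqP; split=> -[].
Qed.

Lemma dis_ge0 p q X Y (g : probability (borel (X * Y)%type) R) :
  1 <= p -> 1 <= q -> 0 <= dis p q g.
Proof. by move=> p1 q1; rewrite dis_coupling// Lnorm_ge0. Qed.

Lemma dis_le p p' q q' X Y (g : probability (borel (X * Y)%type) R) :
  1 <= p -> p <= p' -> 1 <= q -> q <= q' -> dis p q g <= dis p' q' g.
Proof.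
move=> p1 pp' q1 qq'; have p'1 := le_trans p1 pp'; have q'1 := le_trans q1 qq'.
rewrite !dis_coupling//.
have mD q0 := measurable_distortion (@measurable_borel_fst R X Y)
  (@measurable_borel_snd R X Y) q0.
apply: (le_trans _ (Lnorm_le _ p1 pp' (mD q'))).
apply: le_Lnorm_fun => // u; rewrite !ger0_norm ?distortion_ge0//.
by apply: Lambda_le => //; exact: mdist_ge0.
Qed.

Lemma dis_bounded p q X Y (g : probability (borel (X * Y)%type) R) :
  1 <= p -> 1 <= q -> dis p q g < +oo.
Proof.
move=> p1 q1; have [D1 hD1] := compact_mdist_bounded (@mmcompact R X).
have [D2 hD2] := compact_mdist_bounded (@mmcompact R Y).
apply: (@le_lt_trans _ _ (Num.max D1 D2)%:E); last exact: ltry.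
rewrite dis_coupling//; apply: Lnorm_le_bound => //.
  exact: measurable_distortion (@measurable_borel_fst R X Y) (@measurable_borel_snd R X Y) q.
move=> u; rewrite ger0_norm ?distortion_ge0//.
rewrite (le_trans (Lambda_le_max q1 (mdist_ge0 _ _) (mdist_ge0 _ _)))//.
by rewrite ge_max !le_max hD1 hD2 orbT.
Qed.

Lemma dis_swap p q X Y (g : probability (borel (X * Y)%type) R) :
  1 <= p -> 1 <= q -> coupling X Y g ->
  exists2 g', coupling Y X g' & dis p q g' = dis p q g.
Proof.
move=> p1 q1 [gX gY].
exists (joint_law g (@measurable_borel_snd R X Y) (@measurable_borel_fst R X Y)).
  exact: coupling_joint_law.
rewrite dis_joint_law// dis_coupling//; apply: eq_Lnorm => u /=.
by congr (_%:E); exact: Lambda_sym.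
Qed.

(** On the space that glues the two couplings, the distortion of the outer pair
    is at most the sum of the other two, pointwise; conclude with Minkowski's
    inequality. *)
Lemma dis_gluing p q X Y Z (g1 : probability (borel (X * Y)%type) R)
    (g2 : probability (borel (Y * Z)%type) R) :
  1 <= p -> 1 <= q -> coupling X Y g1 -> coupling Y Z g2 ->
  exists2 g, coupling X Z g & dis p q g <= dis p q g1 + dis p q g2.
Proof.
move=> p1 q1 cg1 cg2.
have [d [Om [P [f [g [h [mf [mg [mh [fg gh]]]]]]]]]] := gluing cg1 cg2.
exists (joint_law P mf mh).
  apply: coupling_joint_law => A mA.
    rewrite -(cg1.1 A mA) /pushforward -fg //.
    by rewrite -[X in measurable X]setTI; apply: (measurable_borel_fst measurableT mA).
  rewrite -(cg2.2 A mA) /pushforward -gh //.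
  by rewrite -[X in measurable X]setTI; apply: (measurable_borel_snd measurableT mA).
rewrite -(eq_dis p q fg) -(eq_dis p q gh) !dis_joint_law//.
have mfg := measurable_distortion mf mg q; have mgh := measurable_distortion mg mh q.
apply: le_trans (eminkowski _ mfg mgh p1).
apply: le_Lnorm_fun => //.
- exact: measurable_distortion.
- exact: measurable_funD.
move=> u; rewrite !ger0_norm ?addr_ge0 ?distortion_ge0//.
by apply: Lambda_triangle => //; exact: mdist_ge0.
Qed.

(** The product measure, transported from the product sigma-algebra to the Borel
    one. *)
Lemma coupling_nonempty X Y : coupling X Y !=set0.
Proof.
pose P : probability (borel X * borel Y)%type R := (mmmeasure X \x mmmeasure Y)%E.
have mf : @measurable_fun _ _ (borel X * borel Y)%type (borel X) setT fst by [].
have mg : @measurable_fun _ _ (borel X * borel Y)%type (borel Y) setT snd by [].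
exists (joint_law P mf mg); apply: coupling_joint_law => A mA; rewrite /P /=.
- rewrite (_ : _ @^-1` A = A `*` setT); last first.
    by apply/seteqP; split=> [[]|[x y] []].
  rewrite product_measure1E// -[RHS]mule1; congr (_ * _).
  exact: probability_setT.
- rewrite (_ : _ @^-1` A = setT `*` A); last first.
    by apply/seteqP; split=> [[]|[x y] []].
  rewrite product_measure1E// -[RHS]mul1e; congr (_ * _).
  exact: probability_setT.
Qed.

End dis.

Section dGW.
Context {R : realType}.
Implicit Types (X Y Z : mmspace R) (p q : \bar R).
Local Open Scope ereal_scope.

Let cost p q X Y := ereal_inf [set dis p q g | g in coupling X Y].

Let half_ge0 : 0 <= (2^-1)%:E :> \bar R.
Proof. by rewrite lee_fin invr_ge0. Qed.

Let cost_ge0 p q X Y : 1 <= p -> 1 <= q -> 0 <= cost p q X Y.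
Proof. by move=> p1 q1; apply: le_ereal_inf_tmp => _ [g _ <-]; exact: dis_ge0. Qed.

Let cost_fin p q X Y : 1 <= p -> 1 <= q -> cost p q X Y \is a fin_num.
Proof.
move=> p1 q1; rewrite ge0_fin_numE ?cost_ge0//.
have [g cg] := coupling_nonempty X Y.
apply: le_lt_trans (dis_bounded g p1 q1).
by apply: ereal_inf_lbound; exists g.
Qed.

Lemma dGW_ge0 p q X Y : 1 <= p -> 1 <= q -> 0 <= dGW p q X Y.
Proof. by move=> p1 q1; rewrite mule_ge0// cost_ge0. Qed.

Lemma dGW_fin_num p q X Y : 1 <= p -> 1 <= q -> dGW p q X Y \is a fin_num.
Proof. by move=> p1 q1; rewrite fin_numM// cost_fin. Qed.

Lemma dGW_le p p' q q' X Y : 1 <= p -> p <= p' -> 1 <= q -> q <= q' ->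
  dGW p q X Y <= dGW p' q' X Y.
Proof.
move=> p1 pp' q1 qq'; rewrite lee_pmul2l// ?lte_fin ?invr_gt0//.
apply: le_ereal_inf_tmp => _ [g cg <-]; apply: le_trans (dis_le g p1 pp' q1 qq').
by apply: ereal_inf_lbound; exists g.
Qed.

Let cost_sym_le p q X Y : 1 <= p -> 1 <= q -> cost p q X Y <= cost p q Y X.
Proof.
move=> p1 q1; apply: le_ereal_inf_tmp => _ [g cg <-].
have [g' cg' <-] := dis_swap p1 q1 cg.
by apply: ereal_inf_lbound; exists g'.
Qed.

Lemma dGW_sym p q X Y : 1 <= p -> 1 <= q -> dGW p q X Y = dGW p q Y X.
Proof.
by move=> p1 q1; congr (_ * _); apply/eqP; rewrite eq_le !cost_sym_le.
Qed.

Lemma dGW_triangle p q X Y Z : 1 <= p -> 1 <= q ->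
  dGW p q X Z <= dGW p q X Y + dGW p q Y Z.
Proof.
move=> p1 q1; rewrite -muleDr ?fin_num_adde_defl ?cost_fin//.
rewrite lee_pmul2l// ?lte_fin ?invr_gt0//.
apply/lee_addgt0Pr => e e0; have e20 : (0 < e / 2)%R by rewrite divr_gt0.
have [_ [g1 cg1 <-] g1_lt] := lb_ereal_inf_adherent e20 (cost_fin X Y p1 q1).
have [_ [g2 cg2 <-] g2_lt] := lb_ereal_inf_adherent e20 (cost_fin Y Z p1 q1).
have [g cg g_le] := dis_gluing p1 q1 cg1 cg2.
apply: (@le_trans _ _ (dis p q g)); first by apply: ereal_inf_lbound; exists g.
apply: (le_trans g_le); rewrite [in leRHS](splitr e) EFinD addeACA.
by apply: leeD; exact: ltW.
Qed.

Lemma isometry_continuous (X Y : metricType R) (f : X -> Y) :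
  (forall x x', mdist (f x) (f x') = mdist x x') -> continuous f.
Proof.
move=> fE x; apply/metricType_numDomainType.cvgrPdist_lt => e e0.
near=> x'; rewrite fE.
suff : ball x e x' by rewrite ballEmdist.
by near: x'; exact: nbhsx_ballx.
Unshelve. all: by end_near. Qed.

(** The joint law of the identity and of the isomorphism has distortion 0. *)
Lemma isomorphic_dGW0 p q X Y : 1 <= p -> 1 <= q ->
  isomorphic X Y -> dGW p q X Y = 0.
Proof.
move=> p1 q1 [f [_ fE f_law]]; apply/eqP; rewrite eq_le dGW_ge0// andbT.
rewrite -[leRHS](mule0 (2^-1)%:E) lee_pmul2l// ?lte_fin ?invr_gt0//.
have mid : @measurable_fun _ _ (borel X) (borel X) setT id by [].
have mf : @measurable_fun _ _ (borel X) (borel Y) setT f.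
  by apply: (@continuous_borel_fun X Y); exact: isometry_continuous.
apply: (@le_trans _ _ (dis p q (joint_law (mmmeasure X) mid mf))).
  by apply: ereal_inf_lbound; exists (joint_law (mmmeasure X) mid mf) => //;
    exact: coupling_joint_law.
rewrite dis_joint_law//; apply: Lnorm_le_bound => //.
  exact: measurable_distortion.
by move=> u; rewrite /distortion fE Lambda_xx// normr0.
Qed.

End dGW.

(** * Measures of balls and of thickenings *)

Section metric_measure.
Context {R : realType}.

Lemma metric_ball_open (X : metricType R) (x : X) e : open (ball x e).
Proof.
rewrite openE => y; rewrite ballEmdist /= => xy.
have e0 : 0 < e - mdist x y by rewrite subr_gt0.
apply: filterS (nbhsx_ballx y _ e0) => z; rewrite !ballEmdist /= => yz.
by rewrite (le_lt_trans (metric_triangle x y z))// -ltrBrDl.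
Qed.

Definition thickening (X : metricType R) (V : set X) e := \bigcup_(v in V) ball v e.

Lemma thickening_open (X : metricType R) (V : set X) e : open (thickening V e).
Proof. by apply: bigcup_open => v _; exact: metric_ball_open. Qed.

Lemma bigcap_thickening (X : metricType R) (V : set X) : closed V ->
  V = \bigcap_k thickening V k.+1%:R^-1.
Proof.
move=> cV; apply/seteqP; split=> [x Vx k _|x hx].
  by exists x => //; apply: ballxx; rewrite invr_gt0.
apply: cV => B /nbhs_ballP[e /= e0 xB].
have [k ke] : exists k, k.+1%:R^-1 < e.
  by have [k _ /(_ k (leqnn _))] := near_infty_natSinv_lt (PosNum e0); exists k.
have [v Vv vx] := hx k I; exists v; split => //; apply: xB.
by apply: ball_sym; exact: le_ball (ltW ke) _ _.
Qed.

(** A closed set is the decreasing intersection of its thickenings. *)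
Lemma thickening_le (X : pmetricType R) (m1 m2 : probability (borel X) R) :
  (forall V e, closed V -> 0 < e -> (m1 V <= m2 (thickening V e) + e%:E)%E) ->
  forall V : set X, closed V -> (m1 V <= m2 V)%E.
Proof.
move=> h V cV; pose E k := thickening V k.+1%:R^-1.
have mE k : measurable (E k : set (borel X)).
  by apply: open_borel; exact: thickening_open.
have limE : m2 (E k) @[k --> \oo] --> m2 V.
  rewrite [in m2 V](bigcap_thickening cV).
  apply: (@nonincreasing_cvg_mu _ _ _ m2 E) => //.
  - by rewrite (le_lt_trans (probability_le1 m2 (mE 0%N)))// ltry.
  - exact: bigcapT_measurable.
  - move=> i j ij; apply/subsetPset => x [v Vv vx]; exists v => //.
    by apply: le_ball vx; rewrite lef_pV2 ?posrE// ler_nat.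
have lim0 : (k.+1%:R^-1)%:E @[k --> \oo] --> (0 : \bar R)%E.
  by apply: cvg_EFin; [exact: nearW|exact: cvg_harmonic].
have limS : (m2 (E k) + (k.+1%:R^-1)%:E)%E @[k --> \oo] --> m2 V.
  rewrite -[X in _ --> X]adde0; apply: cvgeD => //.
  by rewrite fin_num_adde_defl.
rewrite -(cvg_lim _ limS)//; apply: lime_ge; first by apply/cvg_ex; eexists; exact: limS.
by apply: nearW => k; apply: h => //; rewrite invr_gt0.
Qed.

Lemma eq_measure_closed (X : pmetricType R) (m1 m2 : probability (borel X) R) :
  (forall V : set X, closed V -> m1 V = m2 V) ->
  forall A, measurable A -> m1 A = m2 A.
Proof.
move=> m12; have m12o (W : set X) : open W -> m1 W = m2 W.
  move=> oW; rewrite -[W]setCK.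
  have mW : measurable (~` W : set (borel X)).
    by apply: closed_borel; exact: open_closedC.
  rewrite (probability_setC m1 mW) (probability_setC m2 mW); congr (1 - _)%E.
  by apply: m12; exact: open_closedC.
apply: (@measure_unique _ R (borel X) (@open X) (fun=> setT)) => //.
- exact: openI.
- by move=> _; exact: openT.
- by apply/seteqP; split=> // u _; exists 0%N.
- by move=> _; rewrite [X in (X < _)%E](_ : _ = 1%E) ?ltry//; exact: probability_setT.
Qed.

Lemma seq_lower_bound_gt0 (T : eqType) (s : seq T) (h : T -> R) :
  (forall y, 0 < h y) -> exists2 m, 0 < m & forall y, y \in s -> m <= h y.
Proof.
move=> h0; elim: s => [|x s [m m0 ms]]; first by exists 1.
exists (Num.min m (h x)); first by rewrite lt_min m0 h0.
by move=> y; rewrite inE ge_min => /predU1P[->|/ms ->//]; rewrite lexx orbT.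
Qed.

(** Finitely many balls of half the radius cover the space; each has positive
    measure by full support, and every ball of radius r contains one of them. *)
Lemma ball_measure_lower_bound (X : mmspace R) r : 0 < r ->
  exists2 m : R, 0 < m & forall x : X, (m%:E <= mmmeasure X (ball x r))%E.
Proof.
move=> r0; have r20 : 0 < r / 2 by rewrite divr_gt0.
have mball (x : X) e : measurable (ball x e : set (borel X)).
  by apply: open_borel; exact: metric_ball_open.
have := @mmcompact R X; rewrite compact_cover.
move=> /(_ X setT (fun x => ball x (r / 2)))[].
- by move=> x _; exact: metric_ball_open.
- by move=> x _; exists x => //; exact: ballxx.
move=> D _ Dcover.
have ball_gt0 x : 0 < fine (mmmeasure X (ball x (r / 2))).
  rewrite fine_gt0// (le_lt_trans (probability_le1 _ (mball _ _))) ?ltry// andbT.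
  have : supp (mmmeasure X) x by rewrite mmfull_support.
  by apply; [exact: metric_ball_open|exact: ballxx].
have [m m0 mD] := seq_lower_bound_gt0 (finmap.enum_fset D) ball_gt0.
exists m => // x; have [y /= yD yx] := Dcover x I.
apply: (@le_trans _ _ (mmmeasure X (ball y (r / 2)))).
  by rewrite -[leRHS]fineK ?fin_num_measure// lee_fin; exact: mD.
apply: le_measure; rewrite ?inE// => z yz.
by rewrite (splitr r); apply: ball_triangle yz; exact: ball_sym.
Qed.

End metric_measure.

(** * Couplings of small distortion *)

Lemma quarters_lt (R : realType) (m : R) : 0 < m -> m / 4 + m / 4 < m.
Proof. by lra. Qed.

Lemma quadrangle_distortion (R : realType) (a b c e p q r : R) :
  a < r -> `|a - b| < r -> `|c - e| < r ->
  p <= a + c -> c <= a + p -> q <= b + e -> e <= b + q -> `|p - q| <= 4 * r.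
Proof. by rewrite !ltr_norml ler_norml; lra. Qed.

Section approximation.
Context {R : realType}.
Variables (X Y : mmspace R) (g : probability (borel (X * Y)%type) R).
Hypothesis cg : coupling X Y g.
Local Open Scope ereal_scope.
Let XY := borel (X * Y)%type.

Let D (z' z : XY) : R := distortion (fst : XY -> X) (snd : XY -> Y) 1 (z', z).
Let mean_dist (z' : XY) : \bar R := \int[g]_z (D z' z)%:E.

Let DE z' z : D z' z = `|mdist z.1 z'.1 - mdist z.2 z'.2|%R.
Proof. by rewrite /D /distortion Lambda1 ?mdist_ge0. Qed.

Let D0 z' z : (0 <= D z' z)%R.
Proof. exact: distortion_ge0. Qed.

Let mD : measurable_fun setT (fun u : XY * XY => (D u.1 u.2)%:E).
Proof.
apply/measurable_EFinP; rewrite (_ : (fun _ => _) =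
  distortion (fst : XY -> X) (snd : XY -> Y) 1); last by apply/funext => -[].
exact: measurable_distortion (@measurable_borel_fst R X Y) (@measurable_borel_snd R X Y) 1.
Qed.

Let D0' u : 0 <= (fun u : XY * XY => (D u.1 u.2)%:E) u.
Proof. by rewrite lee_fin D0. Qed.

Let mmean : measurable_fun setT mean_dist.
Proof. exact (measurable_fun_fubini_tonelli_F (m2 := g) _ mD D0'). Qed.

Let mean0 z : 0 <= mean_dist z.
Proof. by apply: integral_ge0 => z' _; rewrite lee_fin. Qed.

Let mDz z' : measurable_fun setT (D z').
Proof. by apply/measurable_EFinP; apply: (measurable_fun_pair2 z' mD). Qed.

Let disE : dis 1 1 g = \int[g]_z mean_dist z.
Proof.
rewrite dis_coupling ?lexx// Lnorm1 -(fubini_tonelli1 _ mD D0').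
by apply: eq_integral => -[z' z] _ /=; rewrite ger0_norm// distortion_ge0.
Qed.

Definition good_pairs (e : R) : set XY := [set z | mean_dist z < e%:E].

Lemma measurable_good_pairs e : measurable (good_pairs e).
Proof. by rewrite -[good_pairs e]setTI; exact: emeasurable_fun_infty_o. Qed.

Let tail_le (h : XY -> \bar R) (a c : R) : measurable_fun setT h ->
  (forall z, 0 <= h z) -> (0 < a)%R -> \int[g]_z h z <= (a * c)%:E ->
  g [set z | a%:E <= h z] <= c%:E.
Proof.
move=> mh h0 a0; have := le_integral_abse g measurableT mh a0.
rewrite setTI (_ : [set z | a%:E <= `|h z|] = [set z | a%:E <= h z]); last first.
  by apply/seteqP; split=> z /=; rewrite gee0_abs.
rewrite (eq_integral h) => [h1 h2|z _]; last by rewrite gee0_abs.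
by rewrite -(@lee_pmul2l _ a%:E)// -EFinM; exact: le_trans h1 h2.
Qed.

(** Markov's inequality: the (1,1)-distortion is the mean of mean_dist. *)
Lemma measure_bad_pairs_le e c : (0 < e)%R -> dis 1 1 g <= (e * c)%:E ->
  g (~` good_pairs e) <= c%:E.
Proof.
move=> e0; rewrite disE => /(tail_le mmean mean0 e0).
rewrite (_ : [set z | _] = ~` good_pairs e)//.
by apply/seteqP; split=> z; rewrite /good_pairs /= leNgt => /negP.
Qed.

(** Except for mass at most m / 4 each, z1 and z2 preserve up to r the distances
    to other pairs. The pairs whose first point is within r of z1.1 have mass at
    least m, so one of them is a common witness, and comparing through it costs
    at most 4 r. *)
Lemma good_pairs_distortion (r m : R) (z1 z2 : X * Y) : (0 < r)%R -> (0 < m)%R ->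
  (forall x : X, m%:E <= mmmeasure X (ball x r)) ->
  good_pairs (r * (m / 4)) z1 -> good_pairs (r * (m / 4)) z2 ->
  (`|mdist z1.1 z2.1 - mdist z1.2 z2.2| <= 4 * r)%R.
Proof.
move=> r0 m0 hm gz1 gz2.
pose B z := [set z' : XY | r%:E <= (D z z')%:E].
have mB z : measurable (B z).
  by rewrite -[B z]setTI; apply: emeasurable_fun_c_infty => //; exact/measurable_EFinP.
have B_le z : good_pairs (r * (m / 4)) z -> g (B z) <= (m / 4)%:E.
  move=> gz; have mDzE : measurable_fun setT (fun z' => (D z z')%:E).
    exact/measurable_EFinP.
  apply: (@tail_le (fun z' => (D z z')%:E) r (m / 4) mDzE _ r0 (ltW gz)).
  by move=> z'; rewrite lee_fin.
pose C : set XY := [set z | ball z1.1 r z.1].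
have oball : measurable (ball z1.1 r : set (borel X)).
  by apply: open_borel; exact: metric_ball_open.
have gC : m%:E <= g C by rewrite (le_trans (hm z1.1))// -(cg.1 _ oball).
have mC : measurable C.
  by rewrite -[C]setTI; exact: (measurable_borel_fst measurableT oball).
have [z' [/= Cz' nB1 nB2]] : exists z', [/\ C z', ~ B z1 z' & ~ B z2 z'].
  apply: contrapT => nex.
  have CB : C `<=` B z1 `|` B z2.
    move=> z' Cz'; apply: contrapT => /not_orP[n1 n2].
    by apply: nex; exists z'.
  have : m%:E <= (m / 4 + m / 4)%:E.
    apply: (le_trans gC); apply: (@le_trans _ _ (g (B z1 `|` B z2))).
      by apply: le_measure; rewrite ?inE//; exact: measurableU.
    apply: (le_trans (measureU2 _ (mB z1) (mB z2))).
    by rewrite EFinD; apply: leeD; exact: B_le.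
  by rewrite lee_fin leNgt quarters_lt.
have Br z : ~ B z z' -> (D z z' < r)%R.
  by move=> nB; rewrite ltNge; apply/negP => h; apply: nB; rewrite /B /= lee_fin.
have h1 : (mdist z1.1 z'.1 < r)%R by move: Cz'; rewrite /C /= ballEmdist.
have h2 := Br _ nB1; have h3 := Br _ nB2; rewrite !DE in h2 h3.
rewrite (metric_sym z'.1 z1.1) (metric_sym z'.2 z1.2) in h2.
apply: (quadrangle_distortion h1 h2 h3).
- exact: metric_triangle.
- by rewrite (metric_sym z1.1 z'.1); exact: metric_triangle.
- exact: metric_triangle.
- by rewrite (metric_sym z1.2 z'.2); exact: metric_triangle.
Qed.

End approximation.

(** * Almost isometries *)

Section almost_isometry.
Context {R : realType}.
Implicit Types X Y : mmspace R.

Record almost_isometry X Y (e : R) (g : probability (borel (X * Y)%type) R)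
    (S : set (borel (X * Y)%type)) : Prop := AlmostIsometry {
  almost_isometry_coupling : coupling X Y g ;
  almost_isometry_measurable : measurable S ;
  almost_isometry_mass : (g (~` S) < e%:E)%E ;
  almost_isometry_distortion : forall z1 z2, S z1 -> S z2 ->
    `|mdist z1.1 z2.1 - mdist z1.2 z2.2| < e ;
  almost_isometry_densel : forall x, exists2 z, S z & mdist x z.1 < e ;
  almost_isometry_denser : forall y, exists2 z, S z & mdist y z.2 < e }.

(** Take the good pairs of a coupling of small distortion: by Markov's inequality
    their complement weighs less than e and less than any ball of radius e, so
    they also meet the preimage of each such ball. *)
Lemma almost_isometry_exists X Y (e : R) : dGW 1 1 X Y = 0%E -> 0 < e ->
  exists g S, @almost_isometry X Y e g S.
Proof.
move=> XY0 e0; pose r := e / 5; have r0 : 0 < r by rewrite divr_gt0.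
have [m m0 hm] := ball_measure_lower_bound X r0.
have [mX mX0 hX] := ball_measure_lower_bound X e0.
have [mY mY0 hY] := ball_measure_lower_bound Y e0.
(* The halving turns the non-strict Markov bound into a strict one. *)
pose k := Num.min e (Num.min mX mY) / 2.
have min0 : 0 < Num.min e (Num.min mX mY) by rewrite !lt_min e0 mX0.
have k0 : 0 < k by rewrite divr_gt0.
have kmin : k < Num.min e (Num.min mX mY).
  by rewrite /k ltr_pdivrMr// ltr_pMr// ltr1n.
move: (kmin); rewrite !lt_min => /and3P[ke kX kY].
pose t := r * (m / 4); have t0 : 0 < t by rewrite mulr_gt0// divr_gt0.
have tk0 : 0 < t * k by rewrite mulr_gt0.
have [g cg g_lt] : exists2 g, coupling X Y g & (dis 1 1 g < (t * k)%:E)%E.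
  have inf0 : ereal_inf [set dis 1 1 g | g in coupling X Y] = 0%E.
    move/eqP: XY0; rewrite /dGW mule_eq0 => /orP[|/eqP//].
    by rewrite eqe invr_eq0 pnatr_eq0.
  have inf_fin : ereal_inf [set dis 1 1 g | g in coupling X Y] \is a fin_num.
    by rewrite inf0.
  have [_ [g cg <-]] := lb_ereal_inf_adherent tk0 inf_fin.
  by rewrite inf0 add0e => g_lt; exists g.
have badk := measure_bad_pairs_le t0 (ltW g_lt).
have mS := measurable_good_pairs g t.
exists g, (good_pairs g t); split=> //.
- by rewrite (le_lt_trans badk)// lte_fin.
- move=> z1 z2 Sz1 Sz2; have := good_pairs_distortion cg r0 m0 hm Sz1 Sz2.
  by move=> /le_lt_trans; apply; rewrite /r mulrCA gtr_pMr// ltr_pdivrMr// mul1r ltr_nat.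
- move=> x; apply: contrapT => nex.
  have oball : measurable (ball x e : set (borel X)).
    by apply: open_borel; exact: metric_ball_open.
  have mC : measurable [set z : borel (X * Y)%type | ball x e z.1].
    by rewrite -[X in measurable X]setTI; exact: (measurable_borel_fst measurableT oball).
  have : (mX%:E <= k%:E)%E.
    apply: (le_trans (hX x)); rewrite -(cg.1 _ oball) /pushforward; apply: le_trans badk.
    apply: le_measure; rewrite ?inE//; first exact: measurableC.
    by move=> z xz Sz; apply: nex; exists z => //; move: xz; rewrite /= ballEmdist.
  by rewrite lee_fin leNgt kX.
- move=> y; apply: contrapT => nex.
  have oball : measurable (ball y e : set (borel Y)).
    by apply: open_borel; exact: metric_ball_open.
  have mC : measurable [set z : borel (X * Y)%type | ball y e z.2].
    by rewrite -[X in measurable X]setTI; exact: (measurable_borel_snd measurableT oball).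
  have : (mY%:E <= k%:E)%E.
    apply: (le_trans (hY y)); rewrite -(cg.2 _ oball) /pushforward; apply: le_trans badk.
    apply: le_measure; rewrite ?inE//; first exact: measurableC.
    by move=> z xz Sz; apply: nex; exists z => //; move: xz; rewrite /= ballEmdist.
  by rewrite lee_fin leNgt kY.
Qed.

End almost_isometry.

Section ultralimit.
Context {R : realType} {T : metricType R} (U : set_system nat).
Hypothesis UU : UltraFilter U.

(** A cluster point of an ultrafilter is a limit of it, as every set or its
    complement belongs to the ultrafilter. *)
Lemma compact_ultralimit (u : nat -> T) : compact [set: T] ->
  exists l, forall e, 0 < e -> \forall n \near U, mdist l (u n) < e.
Proof.
move=> cT; have [l [_ ul]] := cT (u @ U) _ filterT.
exists l => e e0; have [//|UC] := in_ultra_setVsetC [set n | mdist l (u n) < e] UU.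
have [|x [/= nx]] := ul (~` ball l e) _ _ (nbhsx_ballx l e e0); last by [].
by rewrite /fmap /=; move: UC; rewrite ballEmdist.
Qed.

End ultralimit.

(** * Isometries as ultralimits of almost isometries *)

Lemma isometric_limit_dist (R : realType) (a b c d e : R) :
  `|a - b| < e + e -> `|b - c| < e -> `|c - d| < e + e ->
  `|a - d| < 5 * e.
Proof. by rewrite !ltr_norml; lra. Qed.

Lemma limit_point_dist (R : realType) (a b c h u v w D e : R) :
  a < e -> b < e -> c < e -> h < e -> `|u - v| < e ->
  u <= b + c -> w <= v + h -> D <= a + w -> D < 5 * e.
Proof. by rewrite !ltr_norml; lra. Qed.

Section definiteness.
Context {R : realType} (X Y : mmspace R) (U : set_system nat) (UU : UltraFilter U)
  (eps : nat -> R) (g : nat -> probability (borel (X * Y)%type) R)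
  (S : nat -> set (borel (X * Y)%type)).
Hypothesis eps_small : forall e, 0 < e -> \forall n \near U, eps n < e.
Hypothesis gS : forall n, almost_isometry (eps n) (g n) (S n).

Let near_point n x := cid2 (almost_isometry_densel (gS n) x).
Let p n x : X * Y := s2val (near_point n x).
Let pS n x : S n (p n x). Proof. exact: (s2valP (near_point n x)). Qed.
Let pd n x : mdist x (p n x).1 < eps n. Proof. exact: (s2valP' (near_point n x)). Qed.

Let near_pd x e : 0 < e -> \forall n \near U, mdist x (p n x).1 < e.
Proof.
by move=> /eps_small; apply: filterS => n; exact: lt_trans (pd n x).
Qed.

Let limit x := cid (compact_ultralimit UU (fun n => (p n x).2) (@mmcompact R Y)).
(** The image of x is the ultralimit of the second points of pairs of S n whose
    first points tend to x. *)
Definition limit_isometry x : Y := sval (limit x).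
Let f := limit_isometry.

Let near_f x e : 0 < e -> \forall n \near U, mdist (f x) (p n x).2 < e.
Proof. exact: (svalP (limit x)). Qed.

Let S_dist n z1 z2 : S n z1 -> S n z2 ->
  `|mdist z1.1 z2.1 - mdist z1.2 z2.2| < eps n.
Proof. exact: (almost_isometry_distortion (gS n)). Qed.

Lemma limit_isometryE x x' : mdist (f x) (f x') = mdist x x'.
Proof.
apply/eqP; rewrite -subr_eq0 -normr_eq0 eq_le normr_ge0 andbT.
apply/ler_addgt0Pl => e e0; rewrite addr0; have e5 : 0 < e / 5 by rewrite divr_gt0.
near U => n; rewrite ltW// (_ : e = 5 * (e / 5)); last by rewrite mulrC divfK.
apply: (@isometric_limit_dist _ _ (mdist (p n x).2 (p n x').2)
  (mdist (p n x).1 (p n x').1)) => //.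
- apply: le_lt_trans (mdist_lipschitz _ _ _ _) _; apply: ltrD; near: n; exact: near_f.
- rewrite distrC; apply: (lt_trans (S_dist (pS n x) (pS n x'))); near: n.
  exact: eps_small.
- rewrite distrC; apply: le_lt_trans (mdist_lipschitz _ _ _ _) _.
  by apply: ltrD; near: n; exact: near_pd.
Unshelve. all: by end_near. Qed.

(** The choice of the approximating pairs is immaterial, because S n has
    distortion tending to 0. *)
Lemma limit_isometry_eq (z : nat -> X * Y) x y :
  (\forall n \near U, S n (z n)) ->
  (forall e, 0 < e -> \forall n \near U, mdist x (z n).1 < e) ->
  (forall e, 0 < e -> \forall n \near U, mdist y (z n).2 < e) -> f x = y.
Proof.
move=> Sz zx zy; apply: (@mdist_positivity R).
apply/eqP; rewrite eq_le mdist_ge0 andbT.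
apply/ler_addgt0Pl => e e0; rewrite addr0; have e5 : 0 < e / 5 by rewrite divr_gt0.
near U => n.
have h1 : mdist (f x) (p n x).2 < e / 5 by near: n; exact: near_f.
have h2 : mdist x (p n x).1 < e / 5 by near: n; exact: near_pd.
have h3 : mdist x (z n).1 < e / 5 by near: n; exact: zx.
have h4 : mdist y (z n).2 < e / 5 by near: n; exact: zy.
have h5 : `|mdist (p n x).1 (z n).1 - mdist (p n x).2 (z n).2| < e / 5.
  have Szn : S n (z n) by near: n.
  by apply: (lt_trans (S_dist (pS n x) Szn)); near: n; exact: eps_small.
have t1 := metric_triangle (f x) (p n x).2 y.
have t2 := metric_triangle (p n x).2 (z n).2 y.
have t3 := metric_triangle (p n x).1 x (z n).1.
rewrite (metric_sym (p n x).1 x) in t3; rewrite (metric_sym (z n).2 y) in t2.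
rewrite ltW// (_ : e = 5 * (e / 5)); last by rewrite mulrC divfK.
exact: limit_point_dist h1 h2 h3 h4 h5 t3 t2 t1.
Unshelve. all: by end_near. Qed.

(** Otherwise pairs z n of S n with d (f (z n).1) (z n).2 >= e exist for most n,
    and their ultralimits x and y contradict f x = y. *)
Lemma limit_isometry_near e : 0 < e ->
  \forall n \near U, forall z, S n z -> mdist (f z.1) z.2 < e.
Proof.
move=> e0; pose A := [set n | forall z, S n z -> mdist (f z.1) z.2 < e].
have [//|UC] := in_ultra_setVsetC A UU.
have zP n : exists z, ~ A n -> S n z /\ e <= mdist (f z.1) z.2.
  have [An|/existsNP[z /not_implyP[Sz /negP nz]]] := pselect (A n); last first.
    by exists z => _; rewrite leNgt.
  by exists point.
have [z zPz] := choice zP.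
have [x zx] := compact_ultralimit UU (fun n => (z n).1) (@mmcompact R X).
have [y zy] := compact_ultralimit UU (fun n => (z n).2) (@mmcompact R Y).
have Sz : \forall n \near U, S n (z n) by apply: filterS UC => n /zPz[].
have fxy := limit_isometry_eq Sz zx zy.
have e20 : 0 < e / 2 by rewrite divr_gt0.
near U => n; exfalso.
have [_] : S n (z n) /\ e <= mdist (f (z n).1) (z n).2.
  by apply: zPz; near: n.
rewrite leNgt => /negP; apply.
apply: le_lt_trans (metric_triangle _ y _) _; rewrite (splitr e); apply: ltrD.
  by rewrite -fxy limit_isometryE metric_sym; near: n; exact: zx.
by near: n; exact: zy.
Unshelve. all: by end_near. Qed.

(** For surjectivity, approximate y by second points of pairs of S n: their first
    points have an ultralimit, which is sent to y. *)
Lemma limit_isometry_bijective : bijective f.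
Proof.
have finj : injective f.
  move=> x x' fxx'; apply: (@mdist_positivity R).
  by rewrite -limit_isometryE fxx' mdistxx.
have fsurj y : exists x, f x = y.
  have qP n := almost_isometry_denser (gS n) y.
  pose q n := s2val (cid2 (qP n)).
  have qS n : S n (q n) by exact: (s2valP (cid2 (qP n))).
  have qd n : mdist y (q n).2 < eps n by exact: (s2valP' (cid2 (qP n))).
  have [x qx] := compact_ultralimit UU (fun n => (q n).1) (@mmcompact R X).
  exists x; apply: (limit_isometry_eq (z := q)) => //; first exact: nearW.
  by move=> e e0; apply: filterS (eps_small e0) => n; exact: lt_trans (qd n).
have [h hK] := choice fsurj.
by exists h => // x; apply: finj; rewrite hK.
Qed.

Let mf : @measurable_fun _ _ (borel X) (borel Y) setT f.
Proof.
by apply: (@continuous_borel_fun X Y); apply: isometry_continuous; exact: limit_isometryE.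
Qed.

Let f_law : probability (borel Y) R :=
  distribution (mmmeasure X) (mfun_Sub (mem_set mf)).

Let f_lawE B : f_law B = mmmeasure X (f @^-1` B). Proof. by []. Qed.

Let near_pair (e : R) : 0 < e -> exists n, [/\ eps n < e &
  forall z, S n z -> mdist (f z.1) z.2 < e].
Proof.
move=> e0; near U => n; exists n; split; near: n.
  exact: eps_small.
exact: limit_isometry_near.
Unshelve. all: by end_near. Qed.

Let measure_le_on_S n (A B : set (borel (X * Y)%type)) :
  measurable A -> measurable B -> (forall z, S n z -> A z -> B z) ->
  (g n A <= g n B + (eps n)%:E)%E.
Proof.
move=> mA mB AB; have mS := almost_isometry_measurable (gS n).
have mCS := measurableC mS.
apply: (@le_trans _ _ (g n (B `|` ~` S n))).
  apply: le_measure; rewrite ?inE//; first exact: measurableU.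
  move=> z Az; have [Sz|nSz] := pselect (S n z); last by right.
  by left; exact: AB.
apply: (le_trans (measureU2 _ mB mCS)); apply: leeD => //.
exact/ltW/(almost_isometry_mass (gS n)).
Qed.

(** Up to mass eps n, the coupling g n only charges pairs z with f z.1 close to
    z.2, so each of the two measures of a closed set is at most the other
    measure of a thickening of it. *)
Lemma limit_isometry_law (B : set (borel Y)) :
  measurable B -> mmmeasure X (f @^-1` B) = mmmeasure Y B.
Proof.
rewrite -f_lawE; move: B; apply: eq_measure_closed => V cV.
have pre1 (A : set (borel X)) : measurable A ->
    measurable [set z : borel (X * Y)%type | A z.1].
  by move=> mA; rewrite -[X in measurable X]setTI; exact: (measurable_borel_fst measurableT mA).
have pre2 (A : set (borel Y)) : measurable A ->
    measurable [set z : borel (X * Y)%type | A z.2].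
  by move=> mA; rewrite -[X in measurable X]setTI; exact: (measurable_borel_snd measurableT mA).
have pref (A : set (borel Y)) : measurable A -> measurable (f @^-1` A : set (borel X)).
  by move=> mA; rewrite -[X in measurable X]setTI; exact: mf.
have mV (W : set Y) : closed W -> measurable (W : set (borel Y)) by exact: closed_borel.
have mT (W : set Y) e : measurable (thickening W e : set (borel Y)).
  by apply: open_borel; exact: thickening_open.
apply/eqP; rewrite eq_le; apply/andP; split; apply: thickening_le => // {cV}V e cV e0;
  have [n [ne fn]] := near_pair e0; have [gX gY] := almost_isometry_coupling (gS n).
- rewrite f_lawE -(gX _ (pref _ (mV _ cV))) -(gY _ (mT V e)).
  apply: (@le_trans _ _ (g n [set z | thickening V e z.2] + (eps n)%:E)%E).
    apply: measure_le_on_S; [exact: (pre1 _ (pref _ (mV _ cV)))|exact: (pre2 _ (mT V e))|].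
    by move=> z Sz Vz; exists (f z.1); [exact: Vz|rewrite ballEmdist /=; exact: fn].
  by apply: leeD => //; rewrite lee_fin ltW.
- rewrite f_lawE -(gX _ (pref _ (mT V e))) -(gY _ (mV _ cV)).
  apply: (@le_trans _ _ (g n [set z | thickening V e (f z.1)] + (eps n)%:E)%E).
    apply: measure_le_on_S; [exact: (pre2 _ (mV _ cV))|exact: (pre1 _ (pref _ (mT V e)))|].
    by move=> z Sz Vz; exists z.2; [exact: Vz|rewrite ballEmdist /= metric_sym; exact: fn].
  by apply: leeD => //; rewrite lee_fin ltW.
Qed.

End definiteness.

(** Ultralimit, along a free ultrafilter, of almost isometries with parameter
    1 / (n + 1). *)
Lemma dGW0_isomorphic (R : realType) (X Y : mmspace R) :
  dGW 1 1 X Y = 0%E -> isomorphic X Y.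
Proof.
move=> XY0; have [U [UU ooU]] := ultraFilterLemma eventually_filter.
pose eps n : R := n.+1%:R^-1.
have eps0 n : 0 < eps n by rewrite invr_gt0.
have gS n := cid (almost_isometry_exists XY0 (eps0 n)).
pose g n := sval (gS n); pose S n := sval (cid (svalP (gS n))).
have gSP n : almost_isometry (eps n) (g n) (S n) by exact: (svalP (cid (svalP (gS n)))).
have eps_small e : 0 < e -> \forall n \near U, eps n < e.
  by move=> e0; apply: ooU; exact: (near_infty_natSinv_lt (PosNum e0)).
exists (limit_isometry UU gSP); split.
- exact (limit_isometry_bijective UU eps_small gSP).
- exact (limit_isometryE UU eps_small gSP).
- exact (limit_isometry_law UU eps_small gSP).
Qed.

(** * Isomorphism classes *)

Section isoclass.
Context {R : realType}.
Implicit Types (X Y Z : mmspace R) (p q : \bar R) (C D : isoclass R).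

(** One direction holds for all p and q by direct computation; the other one
    reduces to p = q = 1 by monotonicity. *)
Lemma isomorphicP p q X Y : (1 <= p)%E -> (1 <= q)%E ->
  isomorphic X Y <-> dGW p q X Y = 0%E.
Proof.
move=> p1 q1; split=> [|XY0]; first exact: isomorphic_dGW0.
apply: dGW0_isomorphic; apply/eqP; rewrite eq_le dGW_ge0// andbT -XY0.
exact: dGW_le.
Qed.

Lemma isomorphic_refl X : isomorphic X X.
Proof. by exists id; split=> //; exists id. Qed.

(** Symmetry and transitivity of isomorphism are read off the pseudometric. *)
Lemma isomorphic_sym X Y : isomorphic X Y -> isomorphic Y X.
Proof.
have oneE : (1 <= 1 :> \bar R)%E by exact: lexx.
by move=> /(isomorphicP _ _ oneE oneE) XY; apply/(isomorphicP _ _ oneE oneE); rewrite dGW_sym.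
Qed.

Lemma dGW_isomorphicl p q X X' Y : (1 <= p)%E -> (1 <= q)%E ->
  isomorphic X X' -> dGW p q X Y = dGW p q X' Y.
Proof.
move=> p1 q1 XX'; have /(isomorphicP _ _ p1 q1) X'X := isomorphic_sym XX'.
have /(isomorphicP _ _ p1 q1) {}XX' := XX'.
apply/eqP; rewrite eq_le; apply/andP; split.
  by have := dGW_triangle X X' Y p1 q1; rewrite XX' add0e.
by have := dGW_triangle X' X Y p1 q1; rewrite X'X add0e.
Qed.

Lemma isomorphic_trans X Y Z : isomorphic X Y -> isomorphic Y Z -> isomorphic X Z.
Proof.
have oneE : (1 <= 1 :> \bar R)%E by exact: lexx.
move=> XY YZ; apply/(isomorphicP _ _ oneE oneE).
by rewrite (dGW_isomorphicl _ oneE oneE XY); apply/(isomorphicP _ _ oneE oneE).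
Qed.

Lemma isoclass_inj C D : sval C = sval D -> C = D.
Proof.
case: C D => [A hA] [B hB] /= AB; rewrite {}AB in hA *.
by congr exist; exact: Prop_irrelevance.
Qed.

Lemma class_ofP X Y : class_of X = class_of Y <-> isomorphic X Y.
Proof.
split=> [/(congr1 sval)/= XY|XY].
  have : [set Z | isomorphic Y Z] Y by exact: isomorphic_refl.
  by rewrite -XY.
apply: isoclass_inj; apply/seteqP; split=> Z /=; last exact: isomorphic_trans.
by apply: isomorphic_trans; exact: isomorphic_sym.
Qed.

Definition repr_of C : mmspace R := sval (cid (svalP C)).

Lemma repr_ofK C : class_of (repr_of C) = C.
Proof. exact/isoclass_inj/esym/(svalP (cid (svalP C))). Qed.

End isoclass.

Theorem theorem2 (R : realType) :
  (forall p q : \bar R, (1 <= p)%E -> (1 <= q)%E ->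
     exists d : isoclass R -> isoclass R -> R,
       (forall X Y : mmspace R,
          (d (class_of X) (class_of Y))%:E = dGW p q X Y) /\
       is_metric d) /\
  (forall p p' q q' : \bar R,
     (1 <= p)%E -> (1 <= p')%E -> (1 <= q)%E -> (1 <= q')%E ->
     (p <= p')%E -> (q <= q')%E ->
     forall X Y : mmspace R, (dGW p q X Y <= dGW p' q' X Y)%E).
Proof.
split=> [p q p1 q1|p p' q q' p1 _ q1 _ pp' qq' X Y]; last exact: dGW_le.
pose d (C D : isoclass R) : R := fine (dGW p q (repr_of C) (repr_of D)).
have dE C D : (d C D)%:E = dGW p q (repr_of C) (repr_of D).
  by rewrite fineK// dGW_fin_num.
exists d; split=> [X Y|].
  have repr_iso (Z : mmspace R) : isomorphic (repr_of (class_of Z)) Z.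
    by apply/class_ofP; rewrite repr_ofK.
  rewrite dE (dGW_isomorphicl _ p1 q1 (repr_iso X)) dGW_sym//.
  by rewrite (dGW_isomorphicl _ p1 q1 (repr_iso Y)) dGW_sym.
split=> [C D|C D|C D|C D E].
- by rewrite -lee_fin dE dGW_ge0.
- rewrite -{2}(repr_ofK C) -{2}(repr_ofK D).
  apply: (iff_trans _ (iff_sym (class_ofP _ _))).
  apply: (iff_trans _ (iff_sym (isomorphicP _ _ p1 q1))).
  by rewrite -dE; split=> [->|[]].
- by apply: EFin_inj; rewrite !dE dGW_sym.
- by rewrite -lee_fin EFinD !dE dGW_triangle.
Qed.
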